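(* Let $f\in\mathcal{S}_\kappa$ be defined on $\mathbb{D}\setminus\Lambda$ with $\Lambda$ discrete, and let $\tilde f$ be its (unique) extension to a standard function, which has $q$ poles (counted with multiplicity) and some jumps, all jumps lying in $\mathbb{D}\setminus\Lambda$. Then for every nonempty open set $\Omega\subseteq\mathbb{D}\setminus\Lambda$ there exists a positive integer $n$ such that $$\mathbf{k}_n(f;\Omega)=q+\ell_\Omega,$$ where $\ell_\Omega$ is the number of jumps of $\tilde f$ belonging to $\Omega$ and $\mathbf{k}_n(f;\Omega)=\max_{z_1,\dots,z_n\in\Omega\ \text{distinct}}\mathrm{sq}_-P_n(f;z_1,\dots,z_n)$.
   Context: $\mathbb{D}$ is the open unit disk; a set $\Lambda\subset\mathbb{D}$ is discrete if at most countable with accumulation points only on the unit circle. A Schur function is an analytic $S:\mathbb{D}\to\mathbb{C}$ with $|S|\le1$; a Blaschke product is a rational function analytic on $\mathbb{D}$ and unimodular on the unit circle, its degree being its number of zeros in $\mathbb{D}$ with multiplicity. Pick matrix: $P_n(f;z_1,\dots,z_n)=\left[\frac{1-f(z_i)\overline{f(z_j)}}{1-z_i\overline{z_j}}\right]_{i,j=1}^n$. $\mathrm{sq}_-P$ = number of negative eigenvalues (with multiplicity). $\mathcal{S}_\kappa$: functions on $\mathbb{D}\setminus\Lambda$ ($\Lambda$ discrete) all of whose Pick matrices at distinct points have at most $\kappa$ negative eigenvalues, at least one having exactly $\kappa$. A standard function is $f(z)=S(z)/B(z)$ for $z\notin\mathcal{W}\cup\mathcal{Z}$, $f(z_j)=\gamma_j$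 for $z_j\in\mathcal{Z}$, where $\mathcal{Z}=\{z_1,\dots,z_\ell\}$, $\mathcal{W}$ are disjoint finite sets of distinct points of $\mathbb{D}$; $B$ a Blaschke product of degree $q$, $S$ a Schur function, $\mathcal{W}\subseteq Z(B)\subseteq\mathcal{W}\cup\mathcal{Z}$, $Z(B)\cap Z(S)=\emptyset$; and $S(z_j)/B(z_j)\neq\gamma_j$ if $z_j\notin Z(B)$. Its domain is $\mathbb{D}\setminus\mathcal{W}$; its poles are the zeros of $B$ (with multiplicity) and its jumps are $z_1,\dots,z_\ell$. It is known (and may be assumed) that every $f\in\mathcal{S}_\kappa$ has a unique extension to a standard function whose jumps lie in $\mathbb{D}\setminus\Lambda$. *)

(* Defs.v *)
(* complex numbers R[i] over a realType R (mathcomp-real-closed + mathcomp-reals). *)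
From HB Require Import structures.
From mathcomp Require Import all_boot all_order all_algebra.
From mathcomp Require Import complex.
From mathcomp Require Import boolp reals.
Set Implicit Arguments. Unset Strict Implicit. Unset Printing Implicit Defensive.
Import Order.TTheory GRing.Theory Num.Theory.
Local Open Scope ring_scope.

Section Defs.
Variable R : realType.
Local Notation C := (R[i]).

(* the open unit disk *)
Definition inD (z : C) : Prop := `|z| < 1.

(* open subsets of C *)
Definition openC (O : C -> Prop) : Prop :=
  forall z, O z -> exists r : C, 0 < r /\ forall w, `|w - z| < r -> O w.

(* Lambda is a discrete subset of D: at most countable, contained in D,
   with no accumulation point inside D (so accumulation points lie on the circle). *)
Definition discreteD (L : C -> Prop) : Prop :=
  (forall z, L z -> inD z) /\
  (exists e : nat -> C, forall z, L z -> exists k, e k = z) /\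
  (forall z, inD z -> exists r : C, 0 < r /\
     exists s : seq C, forall w, L w -> `|w - z| < r -> w \in s).

(* complex differentiability at every point of D ("analytic on D") *)
Definition holomorphic_on_D (S : C -> C) : Prop :=
  forall z, inD z -> exists d : C, forall eps : C, 0 < eps ->
    exists delta : C, 0 < delta /\ forall w, inD w ->
      0 < `|w - z| < delta -> `|(S w - S z) / (w - z) - d| < eps.

(* Schur function: analytic on D with |S| <= 1 on D *)
Definition schur (S : C -> C) : Prop :=
  holomorphic_on_D S /\ forall z, inD z -> `|S z| <= 1.

(* the roots (with multiplicity) of a polynomial over the algebraically closed field C *)
Definition proots (p : {poly C}) : seq C := sval (closed_field_poly_normal p).

(* B is a Blaschke product of degree d: a rational function p/q (in lowest terms),
   analytic on D, unimodular on the unit circle; its degree is the number of its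
   zeros in D counted with multiplicity. *)
Definition blaschke (B : C -> C) (d : nat) : Prop :=
  exists p q : {poly C}, coprimep p q /\
    (forall z, `|z| <= 1 -> q.[z] != 0) /\
    (forall z, `|z| <= 1 -> B z = p.[z] / q.[z]) /\
    (forall z, `|z| = 1 -> `|B z| = 1) /\
    d = count (fun r => `|r| < 1) (proots p).

(* Pick matrix P_n(f; z_1, ..., z_n) *)
Definition pick_mx (f : C -> C) (n : nat) (z : 'I_n -> C) : 'M[C]_n :=
  \matrix_(i, j) ((1 - f (z i) * (f (z j))^*) / (1 - z i * (z j)^*)).

(* sq_- : number of negative eigenvalues, counted with (algebraic) multiplicity *)
Definition sqm (n : nat) (A : 'M[C]_n) : nat :=
  count (fun r : C => r < 0) (proots (char_poly A)).

(* admissible point tuples: distinct points of the set O *)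
Definition distinct_in (O : C -> Prop) (n : nat) (z : 'I_n -> C) : Prop :=
  injective z /\ forall i, O (z i).

(* the domain D \ Lambda *)
Definition domD (L : C -> Prop) : C -> Prop := fun z => inD z /\ ~ L z.

(* f (defined on D \ Lambda) belongs to S_kappa *)
Definition S_kappa (L : C -> Prop) (f : C -> C) (kappa : nat) : Prop :=
  (forall n (z : 'I_n -> C), distinct_in (domD L) z -> (sqm (pick_mx f z) <= kappa)%N) /\
  (exists n (z : 'I_n -> C), distinct_in (domD L) z /\ sqm (pick_mx f z) = kappa).

(* k is the value of k_n(f; O) = max over distinct z_1..z_n in O of sq_- P_n(f; z) *)
Definition is_kn (f : C -> C) (O : C -> Prop) (n k : nat) : Prop :=
  (exists z : 'I_n -> C, distinct_in O z /\ sqm (pick_mx f z) = k) /\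
  (forall z : 'I_n -> C, distinct_in O z -> (sqm (pick_mx f z) <= k)%N).

(* the standard function S/B with jumps gamma at the points of Z, domain D \ W *)
Definition std_fun (S B gamma : C -> C) (Z : seq C) : C -> C :=
  fun z => if z \in Z then gamma z else S z / B z.

(* (S, B, Z, gamma, W) are data of a standard function, with B of degree q *)
Definition standard_data (S B : C -> C) (q : nat) (Z : seq C) (gamma : C -> C)
    (W : seq C) : Prop :=
  uniq Z /\ uniq W /\ (forall z, z \in Z -> inD z) /\ (forall w, w \in W -> inD w) /\
  (forall z, z \in Z -> z \notin W) /\
  blaschke B q /\ schur S /\
  (* W subset Z(B) subset W u Z, where Z(B) = zeros of B in D *)
  (forall w, w \in W -> B w = 0) /\
  (forall z, inD z -> B z = 0 -> (z \in W) || (z \in Z)) /\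
  (* Z(B) and Z(S) disjoint *)
  (forall z, inD z -> B z = 0 -> S z != 0) /\
  (* genuine jumps *)
  (forall z, z \in Z -> B z != 0 -> S z / B z != gamma z).

End Defs.

(* Main.v *)
(** Write f = S/B off the jumps, with B a product of q Blaschke factors b_w. Up to
   a congruence, the Pick matrix of f is that of the pairs (B, S), that is
   [(B(z) B(y)^* - S(z) S(y)^* ) / (1 - z y^* )], and a jump contributes a row with
   another pair. The key identity is the Schur complement of the Szego kernel k:
   k(z,y) - k(z,w) k(w,y) / k(w,w) = b_w(z) k(z,y) b_w(y)^*.

   Upper bound: applied q times it shows that k and B k B^* agree on a subspace
   of codimension q, and k - S k S^* is positive by Pick's theorem; the jumps of
   the open set O cost one more dimension each.

   Lower bound: a zero w of B gives the negative vector (0, S(w)), and pivoting on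
   it replaces B by B / b_w. A jump at w, once the zeros are exhausted, gives such
   a vector after subtracting a multiple of (1, S(w)), and pivoting replaces S by
   b_w S. The evaluation of (B, S) at w is not a row of the matrix, but it is a
   limit, in the Szego norm, of combinations of evaluations at points of O, since
   the Blaschke product of many points of a small disc is small at w.

   Pick's theorem comes from Schur's algorithm and Schwarz's lemma; the maximum
   principle behind the latter is deduced from Goursat's bisection argument. *)
Require Import Defs.
From HB Require Import structures.
From mathcomp Require Import all_boot all_order all_algebra.
From mathcomp Require Import complex.
From mathcomp Require Import boolp reals.
From mathcomp Require Import sesquilinear spectral.
From mathcomp Require Import ring lra.
Set Implicit Arguments. Unset Strict Implicit. Unset Printing Implicit Defensive.
Import Order.TTheory GRing.Theory Num.Theory.
Local Open Scope ring_scope.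

(** An evaluation at a point outside [O] is only a limit of admissible vectors, so strict negativity
    is too weak an invariant. The lower bound carries a uniform constant ([negfam]), which survives
    both pivoting and small perturbations. No completed space is needed: vectors are finite lists of
    weighted points. Zeros of B are treated before jumps because a jump may sit at a zero of B,
    where no multiple of (B, S) cancels its first entry; once B has become 1, this is always
    possible. What has to stay non-zero meanwhile is the determinant of each jump vector against (B,
    S) at its point. Multiple zeros need no derivatives: after a pivot, the quotient of B is again
    evaluated at points of [O] other than w. In Schur's algorithm the quotient has no useful value
    at the pivot. Instead of removing singularities, functions are considered off a finite list of
    points, and the maximum principle is proved for bounded functions of that kind. *)

(** * Real-valued modulus on R[i] *)

Section Norm.
Variable R : realType.
Local Notation C := (R[i]).

(* [`|z|] is an element of the partially ordered field [R[i]]; this is the same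
   number in the totally ordered field [R]. *)
Definition modc (z : C) : R := complex.Re `|z|.

Lemma normcE_modc z : `|z| = real_complex R (modc z).
Proof. by rewrite /modc RRe_real // ger0_real. Qed.

Lemma modc_ge0 z : 0 <= modc z.
Proof. by rewrite -(ler0c (modc z)) -normcE_modc. Qed.

Lemma modc_lt z w : (modc z < modc w) = (`|z| < `|w|).
Proof. by rewrite !normcE_modc ltcR. Qed.

Lemma modcM z w : modc (z * w) = modc z * modc w.
Proof. by apply: complexI; rewrite rmorphM /= -!normcE_modc normrM. Qed.

Lemma modc_real (x : R) : modc (real_complex R x) = `|x|.
Proof. by rewrite /modc normc_def /= expr0n addr0 sqrtr_sqr. Qed.

Lemma modc0 : modc 0 = 0.
Proof. by apply: complexI; rewrite -normcE_modc normr0. Qed.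

Lemma modc1 : modc 1 = 1.
Proof. by apply: complexI; rewrite -normcE_modc normr1. Qed.

Lemma modc_nat n : modc n%:R = n%:R.
Proof. by apply: complexI; rewrite -normcE_modc normr_nat rmorph_nat. Qed.

Lemma modc_eq0 z : (modc z == 0) = (z == 0).
Proof. by rewrite -[z == 0]normr_eq0 normcE_modc -(rmorph0 (real_complex R)) (inj_eq (@complexI _)). Qed.

Lemma modc_gt0 z : (0 < modc z) = (z != 0).
Proof. by rewrite lt_neqAle modc_ge0 andbT eq_sym modc_eq0. Qed.

Lemma modcV z : modc z^-1 = (modc z)^-1.
Proof. by apply: complexI; rewrite fmorphV /= -!normcE_modc normfV. Qed.

Lemma modcN z : modc (- z) = modc z.
Proof. by rewrite /modc normrN. Qed.

Lemma modcBC z w : modc (z - w) = modc (w - z).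
Proof. by rewrite /modc distrC. Qed.

Lemma modcX z n : modc (z ^+ n) = modc z ^+ n.
Proof. by apply: complexI; rewrite rmorphXn /= -!normcE_modc normrX. Qed.

Lemma modcJ z : modc z^* = modc z.
Proof. by rewrite /modc norm_conjC. Qed.

Lemma modcD z w : modc (z + w) <= modc z + modc w.
Proof. by rewrite -lecR rmorphD /= -!normcE_modc ler_normD. Qed.

Lemma modcB z w : modc (z - w) <= modc z + modc w.
Proof. by rewrite -(modcN w) modcD. Qed.

Lemma modc_subge z w : modc z - modc w <= modc (z - w).
Proof. by have := modcD (z - w) w; rewrite subrK; lra. Qed.

Lemma modc_sqr z : modc z ^+ 2 = complex.Re z ^+ 2 + complex.Im z ^+ 2.
Proof. by apply: complexI; rewrite rmorphXn /= -normcE_modc add_Re2_Im2. Qed.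

Lemma modc_sqrC z : real_complex R (modc z ^+ 2) = z * z^*.
Proof. by rewrite rmorphXn /= -normcE_modc normCK. Qed.

Lemma modc_geRe z : complex.Re z <= modc z.
Proof.
have := modc_sqr z; have := modc_ge0 z; set a := complex.Re z => h e.
have := sqr_ge0 (complex.Im z); nra.
Qed.

Lemma modc_geIm z : complex.Im z <= modc z.
Proof.
have := modc_sqr z; have := modc_ge0 z; set a := complex.Im z => h e.
have := sqr_ge0 (complex.Re z); nra.
Qed.

Lemma conjB (x y : C) : (x - y)^* = x^* - y^*. Proof. exact: rmorphB. Qed.
Lemma conjD (x y : C) : (x + y)^* = x^* + y^*. Proof. exact: rmorphD. Qed.
Lemma conjM (x y : C) : (x * y)^* = x^* * y^*. Proof. exact: rmorphM. Qed.
Lemma conjV (x : C) : (x^-1)^* = (x^*)^-1. Proof. exact: fmorphV. Qed.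
Lemma conj1 : (1 : C)^* = 1. Proof. exact: rmorph1. Qed.
Definition conjE := (conjB, conjD, conjM, conjV, conj1, @conjCK R[i]).

Lemma modc_prod (I : Type) (r : seq I) (F : I -> C) :
  modc (\prod_(i <- r) F i) = \prod_(i <- r) modc (F i).
Proof. by apply: (big_morph _ modcM modc1). Qed.

Lemma inD_modc z : inD z <-> modc z < 1.
Proof. by rewrite /inD -modc1 modc_lt normr1. Qed.

End Norm.

(** * Goursat's lemma for trapezoidal sums *)

Section Goursat.
Variable R : realType.
Local Notation C := (R[i]).

(** The increment inequality replaces the quotient, so that w = x needs no exclusion. *)
Definition cdiff (g : C -> C) (x : C) : Prop :=
  exists d : C, forall e : R, 0 < e -> exists2 r : R, 0 < r &
    forall w, modc (w - x) < r ->
      modc (g w - g x - d * (w - x)) <= e * modc (w - x).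

(* Trapezoidal sums along dyadic subdivisions replace line integrals: they are
   exact on affine functions and additive under bisection, which is all that
   Goursat's argument uses. *)
Definition trap (g : C -> C) (p q : C) : C := (q - p) * (g p + g q) / 2.

Fixpoint esum (g : C -> C) (y : R -> C) (m : nat) (a b : R) : C :=
  if m is m'.+1 then esum g y m' a ((a + b) / 2) + esum g y m' ((a + b) / 2) b
  else trap g (y a) (y b).

(** The sum around the boundary of a curved rectangle, the image under [z] of [a, b] x [c, d]. *)
Definition rsum (g : C -> C) (z : R -> R -> C) m (a b c d : R) : C :=
  esum g (z^~ c) m a b + esum g (z b) m c d
  - esum g (z^~ d) m a b - esum g (z a) m c d.

(** The inner edges cancel; the depth drops by one because each outer edge is bisected. *)
Lemma rsum_split g z m a b c d :
  let e := (a + b) / 2 in let f := (c + d) / 2 in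
  rsum g z m.+1 a b c d =
    rsum g z m a e c f + rsum g z m e b c f
    + rsum g z m a e f d + rsum g z m e b f d.
Proof. by rewrite /rsum /=; ring. Qed.

Lemma esum_ext g1 g2 y m a b : (forall x, g1 x = g2 x) ->
  esum g1 y m a b = esum g2 y m a b.
Proof. by move=> e; rewrite (funext e). Qed.

Lemma esumD g1 g2 y m a b :
  esum (fun x => g1 x + g2 x) y m a b = esum g1 y m a b + esum g2 y m a b.
Proof.
elim: m a b => [|m IH] a b /=; first by rewrite /trap; ring.
by rewrite !IH; ring.
Qed.

Lemma esumZ k g y m a b :
  esum (fun x => k * g x) y m a b = k * esum g y m a b.
Proof.
elim: m a b => [|m IH] a b /=; first by rewrite /trap; ring.
by rewrite !IH; ring.
Qed.

(** The trapezoidal rule is exact on affine functions, so the sum telescopes to a difference of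
    values of the primitive. *)
Lemma esum_affine al be y m a b :
  esum (fun x => al * x + be) y m a b =
  (al * (y b) ^+ 2 / 2 + be * y b) - (al * (y a) ^+ 2 / 2 + be * y a).
Proof.
elim: m a b => [|m IH] a b /=; last by rewrite !IH; ring.
by rewrite /trap; field.
Qed.

(** The length times maximum estimate; it is additive in the interval, hence uniform in the
    depth. *)
Lemma esum_bound g y L M m a b : 0 <= L -> a <= b ->
  (forall s t, a <= s <= b -> a <= t <= b -> modc (y s - y t) <= L * `|s - t|) ->
  (forall s, a <= s <= b -> modc (g (y s)) <= M) ->
  modc (esum g y m a b) <= L * M * (b - a).
Proof.
move=> L0; elim: m a b => [|m IH] a b ab Hy Hg /=.
  have M0 : 0 <= M by apply: le_trans (modc_ge0 _) (Hg a _); rewrite lexx ab.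
  rewrite /trap !modcM modcV modc_nat.
  have h1 := Hy b a; rewrite !lexx ab ger0_norm ?subr_ge0 // in h1.
  have {}h1 := h1 isT isT.
  have h2 := modcD (g (y a)) (g (y b)).
  have ha := Hg a; rewrite lexx ab in ha; have {}ha := ha isT.
  have hb := Hg b; rewrite lexx ab in hb; have {}hb := hb isT.
  have h : modc (y b - y a) * modc (g (y a) + g (y b)) <= L * (b - a) * (M + M).
    by apply: ler_pM; rewrite ?modc_ge0 //; lra.
  by lra.
have i1 : a <= (a + b) / 2 by lra.
have i2 : (a + b) / 2 <= b by lra.
have h1 : modc (esum g y m a ((a + b) / 2)) <= L * M * ((a + b) / 2 - a).
  by apply: IH => // [s t hs ht|s hs]; [apply: Hy|apply: Hg]; lra.
have h2 : modc (esum g y m ((a + b) / 2) b) <= L * M * (b - (a + b) / 2).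
  by apply: IH => // [s t hs ht|s hs]; [apply: Hy|apply: Hg]; lra.
apply: le_trans (modcD _ _) _.
by apply: le_trans (lerD h1 h2) _; lra.
Qed.

Lemma nested_limit (a h : nat -> R) : (forall n, a n <= a n.+1) ->
  (forall n, a n.+1 + h n.+1 <= a n + h n) -> (forall n, 0 <= h n) ->
  exists x, forall n, a n <= x <= a n + h n.
Proof.
move=> ha hh h0.
have mono n k : a n <= a (n + k)%N.
  by elim: k => [|k IH]; rewrite ?addn0 // addnS; apply: le_trans IH (ha _).
have anti n k : a (n + k)%N + h (n + k)%N <= a n + h n.
  by elim: k => [|k IH]; rewrite ?addn0 // addnS; apply: le_trans (hh _) IH.
have ub n m : a n <= a m + h m.
  have [le|/ltnW le] := leqP n m.
    by have := mono n (m - n)%N; rewrite subnKC // => h1; have := h0 m; lra.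
  by have := anti m (n - m)%N; rewrite subnKC // => h1; have := h0 n; lra.
pose E (x : R) := exists n, x = a n.
exists (sup E) => n; apply/andP; split.
  apply: ub_le_sup; last by exists n.
  by exists (a 0 + h 0) => _ [m ->]; apply: ub.
by apply: ge_sup; [exists (a 0); exists 0%N|move=> _ [m ->]; apply: ub].
Qed.

Lemma half_pow_small (e : R) : 0 < e -> exists n, (2^-1) ^+ n < e.
Proof.
move=> e0; exists (Num.truncn e^-1).+1.
have h := truncnS_gt e^-1; set n := (Num.truncn e^-1).+1 in h *.
have h2 : n%:R < 2 ^+ n :> R by rewrite -natrX ltr_nat ltn_expl.
rewrite exprVn -[e]invrK ltf_pV2 ?posrE ?exprn_gt0 ?invr_gt0 //; lra.
Qed.

Section Bisection.
Variables (g : C -> C) (z : R -> R -> C) (L e : R).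
Hypothesis e0 : 0 < e.
(** Excess at arbitrarily large depths replaces a statement about a limit: the sums need not be
    known to converge, and the pigeonhole principle applies to the four quarters. *)
Let bad (a c h : R) := forall M, exists2 m, (M <= m)%N &
  e * h ^+ 2 < modc (rsum g z m a (a + h) c (c + h)).

Lemma bad_quarter a c h : bad a c h -> exists2 p : R * R, bad p.1 p.2 (h / 2) &
  (p.1 = a \/ p.1 = a + h / 2) /\ (p.2 = c \/ p.2 = c + h / 2).
Proof.
move=> hb; apply: contrapT => hn.
have good p : (p.1 = a \/ p.1 = a + h / 2) /\ (p.2 = c \/ p.2 = c + h / 2) ->
    exists M, forall m, (M <= m)%N ->
      modc (rsum g z m p.1 (p.1 + h / 2) p.2 (p.2 + h / 2)) <= e * (h / 2) ^+ 2.
  move=> hp; apply: contrapT => hM; apply: hn; exists p => // M.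
  apply: contrapT => hm; apply: hM; exists M => m Mm.
  by rewrite leNgt; apply/negP => lt; apply: hm; exists m.
have [M1 h1] := good (a, c) (conj (or_introl erefl) (or_introl erefl)).
have [M2 h2] := good (a, c + h / 2) (conj (or_introl erefl) (or_intror erefl)).
have [M3 h3] := good (a + h / 2, c) (conj (or_intror erefl) (or_introl erefl)).
have [M4 h4] := good (a + h / 2, c + h / 2) (conj (or_intror erefl) (or_intror erefl)).
(* One more than the maximum, since the quarters are summed at depth one less than the square. *)
have [[|m] Mm] := hb (maxn (maxn M1 M2) (maxn M3 M4)).+1 => //.
move: Mm; rewrite ltnS !geq_max => /andP[/andP[m1 m2] /andP[m3 m4]].
rewrite rsum_split.
have -> : (a + (a + h)) / 2 = a + h / 2 by lra.
have -> : (c + (c + h)) / 2 = c + h / 2 by lra.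
have {}h1 := h1 m m1; have {}h2 := h2 m m2.
have {}h3 := h3 m m3; have {}h4 := h4 m m4.
have ea : a + h / 2 + h / 2 = a + h by lra.
have ec : c + h / 2 + h / 2 = c + h by lra.
rewrite /= ?ea ?ec in h1 h2 h3 h4.
move=> lt.
have := modcD (rsum g z m a (a + h / 2) c (c + h / 2) +
  rsum g z m (a + h / 2) (a + h) c (c + h / 2) +
  rsum g z m a (a + h / 2) (c + h / 2) (c + h))
  (rsum g z m (a + h / 2) (a + h) (c + h / 2) (c + h)).
have := modcD (rsum g z m a (a + h / 2) c (c + h / 2) +
  rsum g z m (a + h / 2) (a + h) c (c + h / 2))
  (rsum g z m a (a + h / 2) (c + h / 2) (c + h)).
have := modcD (rsum g z m a (a + h / 2) c (c + h / 2))
  (rsum g z m (a + h / 2) (a + h) c (c + h / 2)).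
have : e * (h / 2) ^+ 2 = e * h ^+ 2 / 4 by field.
lra.
Qed.

Hypothesis L0 : 0 < L.
Hypothesis zlip : forall s s' t t', 0 <= s <= 1 -> 0 <= s' <= 1 -> 0 <= t <= 1 ->
  0 <= t' <= 1 -> modc (z s t - z s' t') <= L * (`|s - s'| + `|t - t'|).
Hypothesis gdiff : forall s t, 0 <= s <= 1 -> 0 <= t <= 1 -> cdiff g (z s t).

(** The affine part of [g] at the point contributes nothing around a closed boundary; the remainder
    is small against h, on a boundary of length of order h. *)
Lemma rsum_near_diff x y : 0 <= x <= 1 -> 0 <= y <= 1 -> exists2 r, 0 < r &
  forall a c h m, 0 <= a -> a + h <= 1 -> 0 <= c -> c + h <= 1 -> 0 <= h < r ->
   a <= x <= a + h -> c <= y <= c + h ->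
   modc (rsum g z m a (a + h) c (c + h)) <= e * h ^+ 2.
Proof.
move=> hx hy; have [d hd] := gdiff hx hy.
(* Four sides of length at most L h, with a remainder at most k (2 L h) on each, give 8 k L^2 h^2 =
   e h^2. *)
pose k := e / (8 * L ^+ 2).
have k0 : 0 < k by rewrite divr_gt0 // mulr_gt0 // exprn_gt0.
have [r r0 hr] := hd _ k0.
exists (r / (2 * L)); first by rewrite divr_gt0 // mulr_gt0.
move=> a c h m a0 a1 c0 c1 /andP[h0 hlt] hxa hyc.
pose x0 := z x y.
pose rem w := g w - g x0 - d * (w - x0).
have gE w : g w = (d * w + (g x0 - d * x0)) + rem w by rewrite /rem; ring.
have hl : 2 * L * h < r by move: hlt; rewrite ltr_pdivlMr ?mulr_gt0 // mulrC.
have remb s t : a <= s <= a + h -> c <= t <= c + h ->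
    modc (rem (z s t)) <= k * (2 * L * h).
  move=> hs ht.
  have dist : modc (z s t - x0) <= 2 * L * h.
    have hz : modc (z s t - x0) <= L * (`|s - x| + `|t - y|) by apply: zlip; lra.
    apply: le_trans hz _.
    have : `|s - x| <= h by rewrite ler_norml; lra.
    have : `|t - y| <= h by rewrite ler_norml; lra.
    by move=> h1 h2; have := ler_wpM2l (ltW L0) (lerD h2 h1); lra.
  apply: le_trans (hr _ (le_lt_trans dist hl)) _.
  by rewrite ler_wpM2l // ltW.
have split y' m' a' b' : esum g y' m' a' b' =
    (d * (y' b') ^+ 2 / 2 + (g x0 - d * x0) * y' b')
    - (d * (y' a') ^+ 2 / 2 + (g x0 - d * x0) * y' a') + esum rem y' m' a' b'.
  by rewrite (esum_ext _ _ _ _ gE) esumD esum_affine.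
have ee : e = k * 8 * L ^+ 2.
  by rewrite /k; field; rewrite lt0r_neq0.
rewrite /rsum !split.
have b1 : modc (esum rem (z^~ c) m a (a + h)) <= L * (k * (2 * L * h)) * (a + h - a).
  apply: esum_bound; [exact: ltW|lra|move=> s t hs ht|move=> s hs; apply: remb; lra].
  have := @zlip s t c c; rewrite subrr normr0 addr0; apply; lra.
have b2 : modc (esum rem (z (a + h)) m c (c + h)) <= L * (k * (2 * L * h)) * (c + h - c).
  apply: esum_bound; [exact: ltW|lra|move=> s t hs ht|move=> s hs; apply: remb; lra].
  have := @zlip (a + h) (a + h) s t; rewrite subrr normr0 add0r; apply; lra.
have b3 : modc (esum rem (z^~ (c + h)) m a (a + h)) <= L * (k * (2 * L * h)) * (a + h - a).
  apply: esum_bound; [exact: ltW|lra|move=> s t hs ht|move=> s hs; apply: remb; lra].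
  have := @zlip s t (c + h) (c + h); rewrite subrr normr0 addr0; apply; lra.
have b4 : modc (esum rem (z a) m c (c + h)) <= L * (k * (2 * L * h)) * (c + h - c).
  apply: esum_bound; [exact: ltW|lra|move=> s t hs ht|move=> s hs; apply: remb; lra].
  have := @zlip a a s t; rewrite subrr normr0 add0r; apply; lra.
set e1 := esum _ _ _ _ _ in b1 *; set e2 := esum _ _ _ _ _ in b2 *.
set e3 := esum _ _ _ _ _ in b3 *; set e4 := esum _ _ _ _ _ in b4 *.
set T := (X in modc X).
have -> : T = e1 + e2 - e3 - e4 by rewrite /T; ring.
have t1 := modcB (e1 + e2 - e3) e4; have t2 := modcB (e1 + e2) e3.
have t3 := modcD e1 e2.
have : e * h ^+ 2 = L * (k * (2 * L * h)) * h * 4 by rewrite ee; ring.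
move=> eq4; rewrite eq4; lra.
Qed.

Lemma goursat_rect : exists M, forall m, (M <= m)%N -> modc (rsum g z m 0 1 0 1) <= e.
Proof.
apply: contrapT => hn.
have b0 : bad 0 0 1.
  move=> M; apply: contrapT => hM; apply: hn; exists M => m Mm.
  rewrite leNgt; apply/negP => lt; apply: hM; exists m => //.
  by rewrite !add0r expr1n mulr1.
(* The second branch only makes [step] total: by [badst] every iterate is bad. *)
pose step (q : R * R * R) : R * R * R :=
  if pselect (bad q.1.1 q.1.2 q.2) is left hb then
    (s2val (cid2 (bad_quarter hb)), q.2 / 2) else q.
pose st n := iter n step ((0, 0), 1).
have badst n : bad (st n).1.1 (st n).1.2 (st n).2.
  elim: n => [//|n IH]; rewrite /st iterS -/(st n) /step.
  by case: pselect => //= hb; case: (cid2 _).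
have stS n : (st n.+1).2 = (st n).2 / 2 /\
   ((st n.+1).1.1 = (st n).1.1 \/ (st n.+1).1.1 = (st n).1.1 + (st n).2 / 2) /\
   ((st n.+1).1.2 = (st n).1.2 \/ (st n.+1).1.2 = (st n).1.2 + (st n).2 / 2).
  rewrite /st iterS -/(st n) /step; have := badst n.
  by case: pselect => //= hb _; case: (cid2 _).
have hst n : (st n).2 = 2^-1 ^+ n.
  by elim: n => [//|n IH]; have [-> _] := stS n; rewrite IH exprSr.
have hpos n : 0 < (st n).2 by rewrite hst exprn_gt0 // invr_gt0.
have [x hx] : exists x, forall n, (st n).1.1 <= x <= (st n).1.1 + (st n).2.
  apply: (@nested_limit (fun n => (st n).1.1) (fun n => (st n).2)) => n.
  - by have := hpos n; have [_ [[]-> _]] := stS n; lra.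
  - by have := hpos n; have [-> [[]-> _]] := stS n; lra.
  - exact: ltW.
have [y hy] : exists y, forall n, (st n).1.2 <= y <= (st n).1.2 + (st n).2.
  apply: (@nested_limit (fun n => (st n).1.2) (fun n => (st n).2)) => n.
  - by have := hpos n; have [_ [_ []->]] := stS n; lra.
  - by have := hpos n; have [-> [_ []->]] := stS n; lra.
  - exact: ltW.
have inU n : [/\ 0 <= (st n).1.1, (st n).1.1 + (st n).2 <= 1,
    0 <= (st n).1.2 & (st n).1.2 + (st n).2 <= 1].
  elim: n => [|n [i1 i2 i3 i4]]; first by rewrite /= !lexx !add0r lexx.
  by have := hpos n; have [-> [[]-> []->]] := stS n; split; lra.
have hx01 : 0 <= x <= 1 by have := hx 0%N; rewrite /= add0r.
have hy01 : 0 <= y <= 1 by have := hy 0%N; rewrite /= add0r.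
have [r r0 hr] := rsum_near_diff hx01 hy01.
have [n hn'] := half_pow_small r0; rewrite -hst in hn'.
have [m _] := badst n 0%N; apply/negP; rewrite -leNgt.
by have [i1 i2 i3 i4] := inU n; apply: hr; rewrite ?hx ?hy ?hn' // ltW.
Qed.

End Bisection.
End Goursat.

(** * Continuity and complex differentiability *)

Section Calculus.
Variable R : realType.
Local Notation C := (R[i]).

Definition ccont (f : C -> C) (x : C) : Prop :=
  forall e : R, 0 < e -> exists2 r : R, 0 < r &
    forall w, modc (w - x) < r -> modc (f w - f x) <= e.

Lemma ccont_cst k x : ccont (fun=> k) x.
Proof. by move=> e e0; exists 1 => // w _; rewrite subrr modc0 ltW. Qed.

Lemma ccont_id x : ccont id x.
Proof. by move=> e e0; exists e => // w /ltW. Qed.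

Lemma ccontD f g x : ccont f x -> ccont g x -> ccont (fun w => f w + g w) x.
Proof.
move=> hf hg e e0; have e2 : 0 < e / 2 by lra.
have [r r0 hr] := hf _ e2; have [s s0 hs] := hg _ e2.
exists (Num.min r s); first by rewrite lt_min r0.
move=> w; rewrite lt_min => /andP[/hr h1 /hs h2].
have -> : f w + g w - (f x + g x) = (f w - f x) + (g w - g x) by ring.
by apply: le_trans (modcD _ _) _; lra.
Qed.

Lemma ccontM f g x : ccont f x -> ccont g x -> ccont (fun w => f w * g w) x.
Proof.
move=> hf hg e e0.
have F0 := modc_ge0 (f x); have G0 := modc_ge0 (g x).
set F := modc (f x) in F0 *; set G := modc (g x) in G0 *.
pose d := Num.min 1 (e / (F + G + 1)).
have d0 : 0 < d by rewrite lt_min ltr01 divr_gt0 //; lra.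
have d1 : d <= 1 by rewrite ge_min lexx.
have de : d * (F + G + 1) <= e.
  by rewrite -ler_pdivlMr ?ge_min ?lexx ?orbT //; lra.
have [r r0 hr] := hf _ d0; have [s s0 hs] := hg _ d0.
exists (Num.min r s); first by rewrite lt_min r0.
move=> w; rewrite lt_min => /andP[/hr h1 /hs h2].
have -> : f w * g w - f x * g x =
  (f w - f x) * (g w - g x) + f x * (g w - g x) + (f w - f x) * g x by ring.
apply: le_trans (modcD _ _) _; rewrite modcM.
apply: le_trans (lerD (modcD _ _) (lexx _)) _; rewrite !modcM -/F -/G.
have := modc_ge0 (f w - f x); have := modc_ge0 (g w - g x).
move: (modc (f w - f x)) (modc (g w - g x)) h1 h2 => a b h1 h2 b0 a0.
apply: le_trans de.
have : a * b <= d * 1 by apply: ler_pM => //; lra.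
have : F * b <= F * d by apply: ler_wpM2l.
have : a * G <= d * G by apply: ler_wpM2r.
lra.
Qed.

Lemma ccontV f x : f x != 0 -> ccont f x -> ccont (fun w => (f w)^-1) x.
Proof.
rewrite -modc_gt0 => F0 hf e e0; set F := modc (f x) in F0 *.
pose d := Num.min (F / 2) (e * F ^+ 2 / 2).
have d0 : 0 < d.
  rewrite lt_min; apply/andP; split; first by lra.
  by rewrite divr_gt0 // mulr_gt0 // exprn_gt0.
have d1 : d <= F / 2 by rewrite ge_min lexx.
have d2 : d <= e * F ^+ 2 / 2 by rewrite ge_min lexx orbT.
have [r r0 hr] := hf _ d0; exists r => // w /hr h1.
have h2 := modc_subge (f x) (f x - f w).
have ee : f x - (f x - f w) = f w by ring.
rewrite ee modcBC -/F in h2.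
have fw : F / 2 <= modc (f w) by lra.
have fw0 : 0 < modc (f w) by lra.
have -> : (f w)^-1 - (f x)^-1 = (f x - f w) / (f w * f x).
  by field; rewrite -!modc_gt0 fw0 F0.
rewrite modcM modcV modcM -/F modcBC ler_pdivrMr ?mulr_gt0 //.
apply: le_trans h1 _; apply: le_trans d2 _.
have : F * (F / 2) <= F * modc (f w) by apply: ler_wpM2l => //; lra.
move=> h3; have := ler_wpM2l (ltW e0) h3; rewrite expr2; lra.
Qed.

Lemma ccont_bounded f x : ccont f x -> exists2 r : R, 0 < r &
  exists K : R, forall w, modc (w - x) < r -> modc (f w) <= K.
Proof.
move=> /(_ 1 ltr01)[r r0 hr]; exists r => //; exists (modc (f x) + 1) => w /hr h.
by have := modc_subge (f w) (f x); lra.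
Qed.

(* Caratheodory's formulation: [ph] is the difference quotient completed by the
   derivative. *)
Lemma cdiffP (f : C -> C) x : cdiff f x <-> exists ph : C -> C, ccont ph x /\
  exists2 r : R, 0 < r & forall w, modc (w - x) < r -> f w - f x = ph w * (w - x).
Proof.
split=> [[d hd]|[ph [hc [r r0 hr]]]].
  exists (fun w => if w == x then d else (f w - f x) / (w - x)); split; last first.
    exists 1 => // w _; case: eqP => [->|/eqP ne]; first by rewrite !subrr mulr0.
    by rewrite divfK // subr_eq0.
  move=> e e0; have [r r0 hr] := hd _ e0; exists r => // w /hr.
  rewrite eqxx; case: eqP => [-> _|/eqP ne]; first by rewrite subrr modc0 ltW.
  rewrite -subr_eq0 -modc_gt0 in ne.
  rewrite -(ler_pdivrMr _ _ ne) -modcV -modcM; congr (modc _ <= _).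
  by field; rewrite -modc_gt0.
exists (ph x) => e e0; have [s s0 hs] := hc _ e0.
exists (Num.min r s); first by rewrite lt_min r0.
move=> w; rewrite lt_min => /andP[/hr -> /hs h].
by rewrite -mulrBl modcM ler_wpM2r ?modc_ge0.
Qed.

Lemma cdiff_cont (f : C -> C) x : cdiff f x -> ccont f x.
Proof.
move=> /cdiffP[ph [hc [r r0 hr]]] e e0.
have : ccont (fun w => ph w * (w + - x)) x.
  by apply: ccontM => //; apply: ccontD; [exact: ccont_id|exact: ccont_cst].
move=> /(_ _ e0)[s s0 hs]; exists (Num.min r s); first by rewrite lt_min r0.
move=> w; rewrite lt_min => /andP[h /hs]; rewrite subrr mulr0 subr0.
by rewrite -hr.
Qed.

Lemma cdiff_cst (k x : C) : cdiff (fun=> k) x.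
Proof.
apply/cdiffP; exists (fun=> 0); split; first exact: ccont_cst.
by exists 1 => // w _; rewrite subrr mul0r.
Qed.

Lemma cdiff_id (x : C) : cdiff id x.
Proof.
apply/cdiffP; exists (fun=> 1); split; first exact: ccont_cst.
by exists 1 => // w _; rewrite mul1r.
Qed.

Lemma cdiffD (f g : C -> C) x : cdiff f x -> cdiff g x -> cdiff (fun w => f w + g w) x.
Proof.
move=> /cdiffP[p [hp [r r0 hr]]] /cdiffP[q [hq [s s0 hs]]].
apply/cdiffP; exists (fun w => p w + q w); split; first exact: ccontD.
exists (Num.min r s); first by rewrite lt_min r0.
move=> w; rewrite lt_min => /andP[/hr h1 /hs h2].
by rewrite mulrDl -h1 -h2; ring.
Qed.

Lemma cdiffM (f g : C -> C) x : cdiff f x -> cdiff g x -> cdiff (fun w => f w * g w) x.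
Proof.
move=> df; have cf := cdiff_cont df; move: df.
move=> /cdiffP[p [hp [r r0 hr]]] /cdiffP[q [hq [s s0 hs]]].
apply/cdiffP; exists (fun w => f w * q w + p w * g x); split.
  by apply: ccontD; apply: ccontM => //; exact: ccont_cst.
exists (Num.min r s); first by rewrite lt_min r0.
move=> w; rewrite lt_min => /andP[/hr h1 /hs h2].
have -> : (f w * q w + p w * g x) * (w - x) =
  f w * (q w * (w - x)) + (p w * (w - x)) * g x by ring.
by rewrite -h1 -h2; ring.
Qed.

Lemma cdiffV (f : C -> C) x : f x != 0 -> cdiff f x -> cdiff (fun w => (f w)^-1) x.
Proof.
move=> fx df; have cf := cdiff_cont df; move: df.
move=> /cdiffP[p [hp [r r0 hr]]].
have F0 : 0 < modc (f x) by rewrite modc_gt0.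
have [s s0 hs] := cf (modc (f x) / 2) (ltac:(lra)).
apply/cdiffP; exists (fun w => (- 1 * p w) * (f w * f x)^-1); split.
  apply: ccontM; first by apply: ccontM => //; exact: ccont_cst.
  apply: (ccontV (f := fun w => f w * f x)); first by rewrite mulf_neq0.
  by apply: ccontM => //; exact: ccont_cst.
exists (Num.min r s); first by rewrite lt_min r0.
move=> w; rewrite lt_min => /andP[/hr h1 /hs h2].
have fw : f w != 0.
  apply/eqP => e; rewrite e sub0r modcN in h2; lra.
have -> : -1 * p w / (f w * f x) * (w - x) = - (p w * (w - x)) / (f w * f x) by ring.
by rewrite -h1; field; rewrite fw fx.
Qed.

Lemma cdiffX (f : C -> C) x n : cdiff f x -> cdiff (fun w => f w ^+ n) x.
Proof.
move=> df; elim: n => [|n IH].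
  by rewrite (_ : (fun _ => _) = (fun=> 1)) //; exact: cdiff_cst.
rewrite (_ : (fun _ => _) = (fun w => f w * f w ^+ n)); first exact: cdiffM.
by apply/funext => w; rewrite exprS.
Qed.

Lemma cdiff_ext (f g : C -> C) x : (exists2 r : R, 0 < r &
    forall w, modc (w - x) < r -> f w = g w) -> cdiff f x -> cdiff g x.
Proof.
move=> [r r0 hr] /cdiffP[p [hp [s s0 hs]]]; apply/cdiffP; exists p; split=> //.
exists (Num.min r s); first by rewrite lt_min r0.
move=> w; rewrite lt_min => /andP[h1 h2].
by rewrite -!hr // ?subrr ?modc0 //; exact: hs.
Qed.

End Calculus.

(** * A rational quarter circle and its winding *)

Section MeanBound.
Variable R : realType.
Local Notation C := (R[i]).
Local Notation rc := (real_complex R).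
Local Notation J := (Complex 0 1 : C).

Lemma sqrJ : J * J = -1. Proof. by rewrite -expr2 sqr_i. Qed.
Lemma modcJ1 : modc J = 1.
Proof. by rewrite /modc normc_def /= expr0n expr1n add0r sqrtr1. Qed.

Definition cline (t : R) : C := 1 + J * rc t.
(* For [t] in [0, 1] this runs through the quarter of the unit circle from 1 to i;
   the Cayley parametrisation keeps every estimate rational. *)
Definition qcirc (t : R) : C := cline t / cline (- t).

Lemma cline_ge1 t : 1 <= modc (cline t).
Proof.
apply: le_trans (modc_geRe _).
by rewrite /cline /= !mul0r mulr0 subr0 addr0.
Qed.

Lemma cline_neq0 t : cline t != 0.
Proof. by rewrite -modc_gt0; have := cline_ge1 t; lra. Qed.

Lemma modc_cline t : modc (cline t) ^+ 2 = 1 + t ^+ 2.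
Proof. by rewrite modc_sqr /cline /= !mul0r mulr0 subr0 addr0 expr1n mul1r !add0r. Qed.

Lemma modc_qcirc t : modc (qcirc t) = 1.
Proof.
rewrite /qcirc modcM modcV; set a := modc _; set b := modc _.
have ab : a ^+ 2 = b ^+ 2 by rewrite !modc_cline sqrrN.
have a1 : 1 <= a := cline_ge1 t; have b1 : 1 <= b := cline_ge1 (- t).
have -> : a = b by apply/eqP; rewrite -(eqrXn2 (n := 2)) ?ab //; lra.
by rewrite divff // gt_eqF //; lra.
Qed.

Lemma qcirc0 : qcirc 0 = 1.
Proof. by rewrite /qcirc oppr0 divff // cline_neq0. Qed.

Lemma qcirc1 : qcirc 1 = J.
Proof.
rewrite /qcirc; apply/eqP; rewrite -(inj_eq (mulIf (cline_neq0 (-1)))).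
rewrite divfK ?cline_neq0 // /cline rmorphN rmorph1 !mulr1 mulrN1 mulrBr mulr1 sqrJ.
by rewrite opprK addrC.
Qed.

Lemma qcircB s t :
  qcirc s - qcirc t = 2 * J * rc (s - t) / (cline (- s) * cline (- t)).
Proof.
rewrite /qcirc; have ns := cline_neq0 (- s); have nt := cline_neq0 (- t).
apply/eqP; rewrite -subr_eq0 -(mulrI_eq0 _ (mulfI (mulf_neq0 ns nt))).
apply/eqP; transitivity (cline s * cline (- t) - cline t * cline (- s)
   - 2 * J * rc (s - t)); first by field; rewrite ns nt.
by rewrite /cline !rmorphN rmorphB; ring.
Qed.

Lemma qcirc_inj : injective qcirc.
Proof.
move=> s t e; apply/eqP; rewrite -subr_eq0 -normr_eq0 -modc_real modc_eq0.
have /eqP := qcircB s t; rewrite e subrr eq_sym !mulf_eq0 invr_eq0 mulf_eq0.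
rewrite !(negbTE (cline_neq0 _)) !orbF -[J == 0]modc_eq0 modcJ1 oner_eq0 orbF.
by rewrite pnatr_eq0.
Qed.

Lemma qcirc_lip s t : modc (qcirc s - qcirc t) <= 2 * `|s - t|.
Proof.
rewrite qcircB.
rewrite !modcM modcV modcM modc_nat modcJ1 mulr1 modc_real.
have h1 := cline_ge1 (- s); have h2 := cline_ge1 (- t).
have h : 1 <= modc (cline (- s)) * modc (cline (- t)).
  by rewrite -[1]mulr1; apply: ler_pM.
rewrite ler_pdivrMr; last by lra.
by rewrite ler_peMr // mulr_ge0.
Qed.

Lemma esum_winding (z0 v : C) m a b : v != 0 -> 0 <= a -> a <= b -> b <= 1 ->
  2 / 5 * (b - a) <=
    complex.Im (esum (fun x => (x - z0)^-1) (fun t => z0 + v * qcirc t) m a b).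
Proof.
move=> v0; elim: m a b => [|m IH] a b a0 ab b1 /=; last first.
  have h1 := IH a ((a + b) / 2) a0 (ltac:(lra)) (ltac:(lra)).
  have h2 := IH ((a + b) / 2) b (ltac:(lra)) (ltac:(lra)) b1.
  by rewrite raddfD /=; lra.
pose X := 1 + a * b; pose Y := b - a.
have X1 : 1 <= X by rewrite /X lerDl mulr_ge0 //; lra.
have X2 : X <= 2.
  have : a * b <= 1 * 1 by apply: ler_pM; lra.
  by rewrite /X; lra.
have XY : 0 < X ^+ 2 + Y ^+ 2.
  by apply: ltr_pwDl; rewrite ?sqr_ge0 // exprn_gt0 //; lra.
have -> : trap (fun x => (x - z0)^-1) (z0 + v * qcirc a) (z0 + v * qcirc b) =
    J * rc (2 * X * Y / (X ^+ 2 + Y ^+ 2)).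
  rewrite /trap.
  have -> : z0 + v * qcirc a - z0 = v * qcirc a by ring.
  have -> : z0 + v * qcirc b - z0 = v * qcirc b by ring.
  have -> : z0 + v * qcirc b - (z0 + v * qcirc a) = v * qcirc b - v * qcirc a by ring.
  have na := cline_neq0 a; have nb := cline_neq0 b.
  have nna := cline_neq0 (- a); have nnb := cline_neq0 (- b).
  pose W := rc X + J * rc Y; pose V := rc X - J * rc Y.
  have JJ : J * J = -1 := sqrJ.
  have wE : cline b * cline (- a) = W.
    transitivity (1 - (J * J) * (rc a * rc b) + J * (rc b - rc a)).
      by rewrite /cline rmorphN; ring.
    by rewrite JJ /W /X /Y rmorphD rmorph1 rmorphM rmorphB; ring.
  have vE : cline (- b) * cline a = V.
    transitivity (1 - (J * J) * (rc a * rc b) - J * (rc b - rc a)).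
      by rewrite /cline rmorphN; ring.
    by rewrite JJ /V /X /Y rmorphD rmorph1 rmorphM rmorphB; ring.
  have W0 : W != 0 by rewrite -wE mulf_neq0.
  have V0 : V != 0 by rewrite -vE mulf_neq0.
  have wv : W * V = rc (X ^+ 2 + Y ^+ 2).
    transitivity (rc X ^+ 2 - (J * J) * rc Y ^+ 2); first by rewrite /W /V; ring.
    by rewrite JJ; ring.
  transitivity ((W / V - V / W) / 2).
    by rewrite -wE -vE /qcirc; field; rewrite v0 na nb nna nnb.
  have -> : rc (2 * X * Y / (X ^+ 2 + Y ^+ 2)) = 2 * (rc X * rc Y) / (W * V).
    by rewrite wv (fmorph_div rc (2 * X * Y)); congr (_ / _); ring.
  transitivity ((W ^+ 2 - V ^+ 2) / (2 * (W * V))); first by field; rewrite W0 V0.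
  have -> : W ^+ 2 - V ^+ 2 = 4 * J * (rc X * rc Y) by rewrite /W /V; ring.
  by field; rewrite W0 V0.
rewrite /= !mul0r mul1r add0r.
rewrite ler_pdivlMr //.
have Y0 : 0 <= Y by rewrite /Y; lra.
have : X ^+ 2 + Y ^+ 2 <= 5 * X.
  have Y1 : Y <= 1 by rewrite /Y; lra.
  have : X * X <= 2 * X by apply: ler_wpM2r; lra.
  have : Y * Y <= 1 * 1 by apply: ler_pM; lra.
  by rewrite !expr2; lra.
rewrite -/Y => h; have := ler_wpM2l Y0 h; lra.
Qed.

End MeanBound.

(** * A Cauchy estimate and the maximum principle *)

Section MaxPrinciple.
Variable R : realType.
Local Notation C := (R[i]).
Local Notation rc := (real_complex R).
Local Notation J := (Complex 0 1 : C).

(** Interpolates affinely between a quarter of the circle of radius r0 about z0 (s = 0) and one of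
    the circle of radius r1 about 0 (s = 1); the unit u selects the quarter. *)
Definition sector (z0 : C) (r0 r1 : R) (u : C) (s t : R) : C :=
  rc (1 - s) * (z0 + rc r0 * u * qcirc t) + rc s * (rc r1 * u * qcirc t).

Section Sector.
Variables (z0 : C) (r0 r1 : R) (u : C).
Hypotheses (u1 : modc u = 1) (zr : modc z0 < r1) (r11 : r1 < 1).
Hypotheses (r00 : 0 < r0) (r0z : modc z0 + r0 < 1).

Lemma modc_arc (r t : R) : 0 <= r -> modc (rc r * u * qcirc t) = r.
Proof. by move=> h; rewrite (modcM (rc r * u)) (modcM (rc r)) u1 modc_qcirc modc_real ger0_norm // !mulr1. Qed.

Lemma arc_lip (r s t : R) : 0 <= r ->
  modc (rc r * u * qcirc s - rc r * u * qcirc t) <= 2 * r * `|s - t|.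
Proof.
move=> h; rewrite -mulrBr (modcM (rc r * u)) (modcM (rc r)) u1 mulr1 modc_real ger0_norm //.
by have := ler_wpM2l h (qcirc_lip s t); lra.
Qed.

Lemma sector_lip (s s' t t' : R) : 0 <= s <= 1 -> 0 <= s' <= 1 -> 0 <= t <= 1 ->
  0 <= t' <= 1 ->
  modc (sector z0 r0 r1 u s t - sector z0 r0 r1 u s' t') <= 4 * (`|s - s'| + `|t - t'|).
Proof.
move=> hs hs' ht ht'; move: (zr) (r11) (r00) (r0z) (modc_ge0 z0) => zr' r11' r00' r0z' z00.
set q := qcirc t; set q' := qcirc t'.
have -> : sector z0 r0 r1 u s t - sector z0 r0 r1 u s' t' =
    rc (1 - s) * (rc r0 * u * q - rc r0 * u * q')
    + rc s * (rc r1 * u * q - rc r1 * u * q')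
    + rc (s - s') * (rc r1 * u * q' - (z0 + rc r0 * u * q')).
  by rewrite /sector -/q -/q' !rmorphB rmorph1; ring.
apply: le_trans (modcD _ _) _; apply: le_trans (lerD (modcD _ _) (lexx _)) _.
rewrite !(modcM (rc _)) !modc_real [`|1 - s|]ger0_norm; last by lra.
rewrite [`|s|]ger0_norm; last by lra.
have h1 := arc_lip t t' (ltW r00).
have r1p : 0 <= r1 by lra.
have h2 := arc_lip t t' r1p.
have h3 : modc (rc r1 * u * q' - (z0 + rc r0 * u * q')) <= 4.
  apply: le_trans (modcB _ _) _; rewrite modc_arc //.
  by have := modcD z0 (rc r0 * u * q'); rewrite (modc_arc _ (ltW r00)); lra.
have T0 := normr_ge0 (t - t'); have S0 := normr_ge0 (s - s').
have h1' : modc (rc r0 * u * q - rc r0 * u * q') <= 4 * `|t - t'|.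
  by apply: le_trans h1 _; apply: ler_wpM2r => //; lra.
have h2' : modc (rc r1 * u * q - rc r1 * u * q') <= 4 * `|t - t'|.
  by apply: le_trans h2 _; apply: ler_wpM2r => //; lra.
have k1 := ler_wpM2l (_ : 0 <= 1 - s) h1'; have k2 := ler_wpM2l (_ : 0 <= s) h2'.
have {}k1 := k1 (ltac:(lra)); have {}k2 := k2 (ltac:(lra)).
have k3 := ler_wpM2l S0 h3; lra.
Qed.

(** The distance to z0 is at least (1 - s) r0 + s (r1 - |z0|). *)
Lemma sector_neq (s t : R) : 0 <= s <= 1 -> sector z0 r0 r1 u s t - z0 != 0.
Proof.
move=> hs; move: (zr) (r11) (r00) (r0z) (modc_ge0 z0) => zr' r11' r00' r0z' z00; rewrite -modc_gt0.
have -> : sector z0 r0 r1 u s t - z0 =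
    rc ((1 - s) * r0 + s * r1) * u * qcirc t - rc s * z0.
  by rewrite /sector !(rmorphD, rmorphN, rmorphM, rmorph1); ring.
apply: lt_le_trans (modc_subge _ _).
have p1 : 0 <= (1 - s) * r0 by apply: mulr_ge0; lra.
have p2 : 0 <= s * (r1 - modc z0) by apply: mulr_ge0; lra.
rewrite modc_arc; last by apply: addr_ge0 => //; apply: mulr_ge0; lra.
rewrite modcM modc_real ger0_norm; last by lra.
have [->|s0] := eqVneq s 0; first by lra.
have : 0 < s * (r1 - modc z0) by apply: mulr_gt0; lra.
lra.
Qed.

Lemma sector_in (s t : R) : 0 <= s <= 1 -> modc (sector z0 r0 r1 u s t) < 1.
Proof.
move=> hs; move: (zr) (r11) (r00) (r0z) (modc_ge0 z0) => zr' r11' r00' r0z' z00.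
apply: le_lt_trans (modcD _ _) _.
rewrite (modcM (rc (1 - s))) (modcM (rc s)) !modc_real [`|1 - s|]ger0_norm; last by lra.
rewrite [`|s|]ger0_norm; last by lra.
rewrite modc_arc; last by lra.
have h := modcD z0 (rc r0 * u * qcirc t); rewrite (modc_arc _ (ltW r00)) in h.
have k := ler_wpM2l (_ : 0 <= 1 - s) h; have {}k := k (ltac:(lra)).
have [->|s1] := eqVneq s 1; first by lra.
have : 0 < (1 - s) * (1 - (modc z0 + r0)) by apply: mulr_gt0; lra.
have : 0 <= s * (1 - r1) by apply: mulr_ge0; lra.
lra.
Qed.

End Sector.

(* Cauchy's formula up to a constant: compare the sums of [H w / (w - z0)] along
   [|w| = r1] and along a tiny circle around [z0], one quarter turn at a time. *)
Lemma cauchy_bound (H : C -> C) (z0 : C) (r1 M : R) :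
  modc z0 < r1 -> r1 < 1 -> (forall w, modc w < 1 -> cdiff H w) ->
  (forall w, modc w = r1 -> modc (H w) <= M) ->
  modc (H z0) <= 5 * M / (r1 - modc z0).
Proof.
move=> zr r11 dH HM; have z00 := modc_ge0 z0.
apply/ler_addgt0Pl => e e0.
have cH : ccont H z0 by apply: cdiff_cont; apply: dH; lra.
have [r r0 hr] := cH (e / 10) (ltac:(lra)).
pose rho := Num.min (r / 2) ((1 - modc z0) / 2).
have rho0 : 0 < rho by rewrite lt_min; apply/andP; split; lra.
have rho1 : rho <= r / 2 by rewrite ge_min lexx.
have rho2 : rho <= (1 - modc z0) / 2 by rewrite ge_min lexx orbT.
have rho3 : modc z0 + rho < 1 by lra.
pose g w := H w * (w - z0)^-1.
pose E u := sector z0 rho r1 u.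
have gour u : modc u = 1 -> exists m0, forall m, (m0 <= m)%N ->
    modc (rsum g (E u) m 0 1 0 1) <= e / 10.
  move=> u1; apply: (goursat_rect (L := 4)); first by lra.
  - by [].
  - by move=> *; apply: sector_lip.
  move=> s t hs ht; apply: cdiffM; first by apply: dH; apply: sector_in.
  apply: (cdiffV (f := fun w => w - z0)); first exact: sector_neq.
  by apply: cdiffD; [exact: cdiff_id|exact: cdiff_cst].
pose inner u m := esum g (E u 0) m 0 1.
pose outer u m := esum g (E u 1) m 0 1.
pose side u t m := esum g ((E u)^~ t) m 0 1.
have rsumE u m : rsum g (E u) m 0 1 0 1 = side u 0 m + outer u m - side u 1 m - inner u m.
  by [].
(* The end side of a sector is the initial side of the next one, so the radial sides cancel over a
   full turn. *)
have sideJ u m : side u 1 m = side (u * J) 0 m.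
  rewrite /side; congr (esum _ _ _ _ _); apply/funext => s.
  by rewrite /E /sector qcirc1 qcirc0; ring.
have side4 m : side (1 * J * J * J) 1 m = side 1 0 m.
  rewrite sideJ; congr (side _ _ _).
  by rewrite !mul1r -mulrA sqrJ mulrNN mulr1.
have E0 u : E u 0 = fun t => z0 + rc rho * u * qcirc t.
  by apply/funext => t; rewrite /E /sector subr0 rmorph1 rmorph0 mul0r addr0 mul1r.
have E1 u : E u 1 = fun t => rc r1 * u * qcirc t.
  by apply/funext => t; rewrite /E /sector subrr rmorph1 rmorph0 mul0r add0r mul1r.
have outerB u m : modc u = 1 -> modc (outer u m) <= 2 * (M / (r1 - modc z0)).
  move=> u1; rewrite /outer -[X in _ <= X]mulr1 -[X in _ * X](subr0 1).
  apply: esum_bound => //.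
    move=> s t _ _; rewrite !E1; apply: le_trans (arc_lip u1 s t _) _; first by lra.
    by apply: ler_wpM2r => //; lra.
  move=> s _; rewrite E1 /g modcM modcV.
  have r1p : 0 <= r1 by lra.
  have q1 := modc_arc u1 s r1p.
  have h := modc_subge (rc r1 * u * qcirc s) z0; rewrite q1 in h.
  have hM := HM _ q1.
  apply: ler_pM => //; rewrite ?modc_ge0 ?invr_ge0 ?modc_ge0 //.
  by rewrite lef_pV2 ?posrE //; lra.
pose wind u m := esum (fun x => (x - z0)^-1) (E u 0) m 0 1.
have windI u m : modc u = 1 -> 2 / 5 <= complex.Im (wind u m).
  move=> u1; rewrite /wind E0 -[X in X <= _]mulr1 -[X in _ * X <= _](subr0 1).
  by apply: esum_winding => //; rewrite -modc_gt0 modcM u1 modc_real ger0_norm; lra.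
have innerB u m : modc u = 1 -> modc (inner u m - H z0 * wind u m) <= 2 * (e / 10).
  move=> u1; rewrite /inner /wind -esumZ.
  have gE x : g x = H z0 * (x - z0)^-1 + (H x - H z0) * (x - z0)^-1.
    by rewrite /g; ring.
  rewrite (esum_ext _ _ _ _ gE) esumD addrC addKr.
  have -> : 2 * (e / 10) = (2 * rho) * (e / 10 / rho) * (1 - 0).
    by field; rewrite gt_eqF.
  apply: esum_bound => //; first by lra.
    move=> s t _ _; rewrite E0 /= (_ : _ + _ - (_ + _) =
      rc rho * u * qcirc s - rc rho * u * qcirc t); last by ring.
    by apply: arc_lip => //; lra.
  move=> s _; rewrite E0 modcM modcV.
  have q1 := modc_arc u1 s (ltW rho0).
  have -> : z0 + rc rho * u * qcirc s - z0 = rc rho * u * qcirc s by ring.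
  rewrite q1; apply: ler_wpM2r; first by rewrite invr_ge0 ltW.
  apply: hr; have -> : z0 + rc rho * u * qcirc s - z0 = rc rho * u * qcirc s by ring.
  by rewrite q1; lra.
have n1 : modc (1 : C) = 1 := modc1 R.
have n2 : modc (1 * J) = 1 by rewrite modcM n1 modcJ1 mulr1.
have n3 : modc (1 * J * J) = 1 by rewrite modcM n2 modcJ1 mulr1.
have n4 : modc (1 * J * J * J) = 1 by rewrite modcM n3 modcJ1 mulr1.
have [m1 g1] := gour _ n1; have [m2 g2] := gour _ n2.
have [m3 g3] := gour _ n3; have [m4 g4] := gour _ n4.
pose m := maxn (maxn m1 m2) (maxn m3 m4).
have {}g1 := g1 m (ltac:(by rewrite !leq_max leqnn)).
have {}g2 := g2 m (ltac:(by rewrite !leq_max leqnn ?orbT)).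
have {}g3 := g3 m (ltac:(by rewrite !leq_max leqnn ?orbT)).
have {}g4 := g4 m (ltac:(by rewrite !leq_max leqnn ?orbT)).
rewrite !rsumE !sideJ in g1 g2 g3 g4.
have s4 := side4 m; rewrite sideJ in s4; rewrite s4 in g4.
have o1 := outerB _ m n1; have o2 := outerB _ m n2.
have o3 := outerB _ m n3; have o4 := outerB _ m n4.
have i1 := innerB _ m n1; have i2 := innerB _ m n2.
have i3 := innerB _ m n3; have i4 := innerB _ m n4.
have w1 := windI _ m n1; have w2 := windI _ m n2.
have w3 := windI _ m n3; have w4 := windI _ m n4.
clearbody inner outer side wind.
move: n1 n2 n3 n4 g1 g2 g3 g4 o1 o2 o3 o4 i1 i2 i3 i4 w1 w2 w3 w4.
move: (1 : C) (1 * J) (1 * J * J) (1 * J * J * J) => u1 u2 u3 u4 _ _ _ _.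
move: (inner u1 m) (inner u2 m) (inner u3 m) (inner u4 m) => I1 I2 I3 I4.
move: (outer u1 m) (outer u2 m) (outer u3 m) (outer u4 m) => O1 O2 O3 O4.
move: (side u1 0 m) (side u2 0 m) (side u3 0 m) (side u4 0 m) => S1 S2 S3 S4.
move: (wind u1 m) (wind u2 m) (wind u3 m) (wind u4 m) => W1 W2 W3 W4.
move=> g1 g2 g3 g4 o1 o2 o3 o4 i1 i2 i3 i4 w1 w2 w3 w4.
set K := M / (r1 - modc z0) in o1 o2 o3 o4.
have hw : 8 / 5 <= modc (W1 + W2 + W3 + W4).
  have ImD (x y : C) : complex.Im (x + y) = complex.Im x + complex.Im y.
    by case: x; case: y.
  apply: le_trans (modc_geIm _); rewrite !ImD; lra.
(* Outer arcs cost 2 K each, Goursat errors e/10 each, inner arcs 2 e/10 each. Dividing by the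
   winding 8/5 gives 5 K and an error below e. *)
have ub : modc (H z0 * (W1 + W2 + W3 + W4)) <= 8 * K + 12 * (e / 10).
  have -> : H z0 * (W1 + W2 + W3 + W4) = (O1 + O2 + O3 + O4)
    - ((S1 + O1 - S2 - I1) + (S2 + O2 - S3 - I2) + (S3 + O3 - S4 - I3)
       + (S4 + O4 - S1 - I4))
    - ((I1 - H z0 * W1) + (I2 - H z0 * W2) + (I3 - H z0 * W3) + (I4 - H z0 * W4)).
    by ring.
  have add4 (a b c d : C) : modc (a + b + c + d) <= modc a + modc b + modc c + modc d.
    by have := modcD (a + b + c) d; have := modcD (a + b) c; have := modcD a b; lra.
  apply: le_trans (modcB _ _) _; apply: le_trans (lerD (modcB _ _) (lexx _)) _.
  apply: le_trans (lerD (lerD (add4 _ _ _ _) (add4 _ _ _ _)) (add4 _ _ _ _)) _.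
  lra.
rewrite modcM in ub.
have h0 := modc_ge0 (H z0).
have := ler_wpM2l h0 hw => hh.
rewrite -mulrA -/K; lra.
Qed.

Lemma bernoulli_pow (x : R) n : 0 <= x -> 1 + n%:R * x <= (1 + x) ^+ n.
Proof.
move=> x0; elim: n => [|n IH]; first by rewrite mul0r addr0 expr0.
rewrite exprSr -natr1.
have h := ler_wpM2r (_ : 0 <= 1 + x) IH; have {}h := h (ltac:(lra)).
have : 0 <= n%:R * x * x by rewrite !mulr_ge0.
lra.
Qed.

Lemma pow_unbounded (K x : R) : 1 < x -> exists n, K < x ^+ n.
Proof.
move=> x1; pose y := x - 1; have y0 : 0 < y by rewrite /y; lra.
exists (Num.truncn (K / y)).+1.
have h := truncnS_gt (K / y); set n := _.+1 in h *.
rewrite ltr_pdivrMr // in h.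
have := bernoulli_pow n (ltW y0); have -> : 1 + y = x by rewrite /y; ring.
lra.
Qed.

Lemma pow_tends0 (e x : R) : 0 <= x < 1 -> 0 < e -> exists n, x ^+ n < e.
Proof.
move=> /andP[x0 x1] e0; have [->|xn] := eqVneq x 0; first by exists 1%N; rewrite expr1.
have xp : 0 < x by rewrite lt_neqAle eq_sym xn.
have x1' : 1 < x^-1 by rewrite invf_gt1.
have [n hn] := pow_unbounded e^-1 x1'; exists n.
rewrite -[x]invrK exprVn -[e]invrK ltf_pV2 ?posrE ?invr_gt0 //.
by rewrite exprn_gt0 ?invr_gt0.
Qed.

(* The constant of [cauchy_bound] and the removed singularities disappear when
   the bound is applied to [f ^+ n * \prod (z - e) ^+ 2] and [n] grows. *)
Lemma max_principle (f : C -> C) (E : seq C) (K : R) :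
  (forall z, modc z < 1 -> z \notin E -> cdiff f z) ->
  (forall z, modc z < 1 -> z \notin E -> modc (f z) <= K) ->
  (forall e : R, 0 < e -> exists2 rho : R, rho < 1 &
     forall z, rho < modc z < 1 -> z \notin E -> modc (f z) <= 1 + e) ->
  forall z, modc z < 1 -> z \notin E -> modc (f z) <= 1.
Proof.
move=> df fK fb z0 z01 z0E; apply/ler_addgt0Pl => e e0; rewrite addrC.
have [rho rho1 hrho] := fb _ e0; have z00 := modc_ge0 z0.
pose r1 := (1 + Num.max rho (modc z0)) / 2.
have mx : Num.max rho (modc z0) < 1 by rewrite gt_max rho1.
have m1 : rho <= Num.max rho (modc z0) by rewrite le_max lexx.
have m2 : modc z0 <= Num.max rho (modc z0) by rewrite le_max lexx orbT.
have r11 : r1 < 1 by rewrite /r1; lra.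
have rz : modc z0 < r1 by rewrite /r1; lra.
have rr : rho < r1 by rewrite /r1; lra.
pose P z := \prod_(x <- E) (z - x) ^+ 2.
have dP z : cdiff P z.
  rewrite /P; elim: (E) => [|x s IH].
    by rewrite (_ : (fun _ => _) = fun=> 1); [exact: cdiff_cst|apply/funext => w; rewrite big_nil].
  rewrite (_ : (fun _ => _) = (fun w => (w - x) ^+ 2 * \prod_(y <- s) (w - y) ^+ 2)).
    apply: cdiffM => //; apply: (cdiffX (f := fun w => w - x)).
    by apply: cdiffD; [exact: cdiff_id|exact: cdiff_cst].
  by apply/funext => w; rewrite big_cons.
(* As [f] is bounded, the squares in [P] make [H] vanish to second order on [E], so it is
   differentiable there with derivative 0. *)
pose H n z := (if z \in E then 0 else f z ^+ n) * P z.
have Pz z : z \in E -> P z = 0.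
  by move=> zE; apply/eqP; rewrite prodf_seq_eq0; apply/hasP; exists z; rewrite //= subrr expr0n.
have sep z : exists2 r : R, 0 < r & forall w, modc (w - z) < r -> w \in E -> w = z.
  elim: (E) => [|x s [r r0 IH]]; first by exists 1.
  have [xz|ne] := eqVneq x z.
    by exists r => // w hw; rewrite inE => /orP[/eqP ->//|]; exact: IH.
  exists (Num.min r (modc (x - z))); first by rewrite lt_min r0 modc_gt0 subr_eq0.
  move=> w; rewrite lt_min => /andP[hw lt]; rewrite inE => /orP[/eqP wx|]; last exact: IH.
  by rewrite wx ltxx in lt.
have dH n z : modc z < 1 -> cdiff (H n) z.
  move=> z1; have [r r0 hr] := sep z; have [zE|zE] := boolP (z \in E); last first.
    apply: (cdiff_ext (f := fun w => f w ^+ n * P w)); last first.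
      by apply: cdiffM => //; apply: cdiffX; apply: df.
    exists r => // w hw; rewrite /H; case: ifP => // wE.
    by rewrite -(hr _ hw wE) wE in zE.
  pose K' := Num.max 0 K ^+ n.
  have K0 : 0 <= K' by rewrite exprn_ge0 // le_max lexx.
  pose Q w := \prod_(x <- rem z E) (w - x) ^+ 2.
  have PQ w : P w = (w - z) ^+ 2 * Q w.
    by rewrite /P /Q (perm_big _ (perm_to_rem zE)) big_cons.
  have cQ : ccont Q z.
    rewrite /Q; elim: (rem z E) => [|x s IH].
      by rewrite (_ : (fun _ => _) = fun=> 1); [exact: ccont_cst|apply/funext => w; rewrite big_nil].
    rewrite (_ : (fun _ => _) = (fun w => (w - x) ^+ 2 * \prod_(y <- s) (w - y) ^+ 2)).
      apply: ccontM => //; apply: cdiff_cont; apply: (cdiffX (f := fun w => w - x)).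
      by apply: cdiffD; [exact: cdiff_id|exact: cdiff_cst].
    by apply/funext => w; rewrite big_cons.
  have [s s0 [KQ hQ]] := ccont_bounded cQ.
  have KQ0 : 0 <= KQ by apply: le_trans (modc_ge0 _) (hQ z _); rewrite subrr modc0.
  exists 0 => d d0.
  exists (Num.min (Num.min s (1 - modc z)) (d / (K' * KQ + 1))).
    rewrite !lt_min s0 subr_gt0 z1 /= divr_gt0 //.
    by have := mulr_ge0 K0 KQ0; lra.
  move=> w; rewrite !lt_min => /andP[/andP[h1 h2] h3].
  rewrite mul0r subr0 {2}/H zE mul0r subr0 /H.
  case: ifP => wE; first by rewrite mul0r modc0 mulr_ge0 ?modc_ge0 // ltW.
  have w1 : modc w < 1 by have := modc_subge w z; lra.
  have fw := fK _ w1 (negbT wE).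
  have fw' : modc (f w) ^+ n <= K'.
    by rewrite /K' lerXn2r ?nnegrE ?modc_ge0 ?le_max ?lexx ?fw ?orbT.
  have -> : modc (f w ^+ n * P w) =
      modc (w - z) * (modc (w - z) * (modc (f w) ^+ n * modc (Q w))).
    by rewrite PQ (modcM (f w ^+ n)) modcX (modcM (_ ^+ 2)) modcX; ring.
  have dd := hQ _ h1; have wz := modc_ge0 (w - z).
  rewrite ltr_pdivlMr in h3; last by have := mulr_ge0 K0 KQ0; lra.
  have fQ : modc (f w) ^+ n * modc (Q w) <= K' * KQ.
    by apply: ler_pM; rewrite ?exprn_ge0 ?modc_ge0.
  rewrite [X in _ <= X]mulrC; apply: ler_wpM2l => //.
  have : modc (w - z) * (modc (f w) ^+ n * modc (Q w)) <= modc (w - z) * (K' * KQ).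
    exact: ler_wpM2l.
  lra.
have r1p : 0 <= r1 by lra.
have [KP KP0 hP] : exists2 KP : R, 0 < KP & forall w, modc w <= 1 -> modc (P w) <= KP.
  rewrite /P; elim: (E) => [|x s [KP KP0 IH]].
    by exists 1 => // w _; rewrite big_nil modc1.
  have x0 := modc_ge0 x.
  exists ((1 + modc x) ^+ 2 * KP); first by rewrite mulr_gt0 // exprn_gt0 //; lra.
  move=> w w1; rewrite big_cons modcM modcX.
  apply: ler_pM; rewrite ?exprn_ge0 ?modc_ge0 //; last exact: IH.
  by rewrite lerXn2r ?nnegrE ?modc_ge0 //; have := modcB w x; lra.
have bH n w : modc w = r1 -> modc (H n w) <= (1 + e) ^+ n * KP.
  move=> wr; have e1 : 0 <= (1 + e) ^+ n by apply: exprn_ge0; lra.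
  rewrite /H; case: ifP => wE.
    by rewrite mul0r modc0 mulr_ge0 // ltW.
  rewrite modcM modcX.
  have fw : modc (f w) <= 1 + e by apply: hrho; rewrite ?wr ?rr ?wE.
  apply: ler_pM; rewrite ?exprn_ge0 ?modc_ge0 //; last by apply: hP; lra.
  by rewrite lerXn2r ?nnegrE ?modc_ge0 //; lra.
have Pz0 : 0 < modc (P z0).
  rewrite modc_gt0 /P prodf_seq_neq0; apply/allP => x xE /=.
  by rewrite expf_neq0 // subr_eq0; apply: contraNneq z0E => ->.
have main n : modc (f z0) ^+ n * modc (P z0) <= (1 + e) ^+ n * (5 * KP / (r1 - modc z0)).
  have := cauchy_bound rz r11 (dH n) (bH n).
  by rewrite {1}/H (negbTE z0E) modcM modcX; lra.
rewrite leNgt; apply/negP => lt.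
have e1 : 0 < 1 + e by lra.
have gt1 : 1 < modc (f z0) / (1 + e) by rewrite ltr_pdivlMr // mul1r.
have [n] := pow_unbounded (5 * KP / (r1 - modc z0) / modc (P z0)) gt1.
apply/negP; rewrite -leNgt expr_div_n ler_pdivrMr ?exprn_gt0 //.
by rewrite mulrAC ler_pdivlMr // [X in _ <= X]mulrC.
Qed.

End MaxPrinciple.

(** * The Szego form on finite lists, and its positivity *)

Section Szego.
Variable R : realType.
Local Notation C := (R[i]).
Local Notation rc := (real_complex R).

Definition szk (z w : C) : C := (1 - z * w^*)^-1.
Definition bf (w z : C) : C := (z - w) / (1 - w^* * z).

(* A list of pairs (point, weight) stands for the combination of point
   evaluations with these weights; [sz] is the Szego form on them. *)
Definition sz (u v : seq (C * C)) : C :=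
  \sum_(a <- u) \sum_(b <- v) a.2 * b.2^* * szk a.1 b.1.
Definition sq (u : seq (C * C)) : R := complex.Re (sz u u).
(** The functional [u] precomposed with multiplication by [g]; contractivity of the multiplier [g]
    reads [sq (wt g u) <= sq u]. *)
Definition wt (g : C -> C) (u : seq (C * C)) := [seq (a.1, g a.1 * a.2) | a <- u].
Definition inDs (u : seq (C * C)) := all (fun a => modc a.1 < 1) u.

Lemma sub1_neq0 (z w : C) : modc z < 1 -> modc w < 1 -> 1 - z * w^* != 0.
Proof.
move=> z1 w1; rewrite -modc_gt0; apply: lt_le_trans (modc_subge _ _).
rewrite modc1 modcM modcJ.
have : modc z * modc w <= modc z * 1 by apply: ler_wpM2l; rewrite ?modc_ge0 ?ltW.
lra.
Qed.

Lemma sub1_neq0' (z w : C) : modc z < 1 -> modc w < 1 -> 1 - w^* * z != 0.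
Proof. by rewrite mulrC; exact: sub1_neq0. Qed.

Lemma conj_sub1 (z w : C) : (1 - z * w^*)^* = 1 - w * z^*.
Proof. by rewrite !conjE mulrC. Qed.

Lemma szkJ z w : (szk z w)^* = szk w z.
Proof. by rewrite /szk conjV conj_sub1. Qed.

Lemma szk_schur w z y : modc w < 1 -> modc z < 1 -> modc y < 1 ->
  szk z y = bf w z * (bf w y)^* * szk z y
    + (1 - w * w^*) * (szk z w * szk w y).
Proof.
move=> hw hz hy; rewrite /bf !conjE /szk.
have n1 := sub1_neq0 hz hy; have n2 := sub1_neq0 hz hw; have n3 := sub1_neq0 hw hy.
have n4 := sub1_neq0' hz hw.
by field; rewrite ?n1 ?n2 ?n3 ?n4.
Qed.

Lemma sz_nill v : sz [::] v = 0. Proof. by rewrite /sz big_nil. Qed.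

Lemma sz_catl u u' v : sz (u ++ u') v = sz u v + sz u' v.
Proof. by rewrite /sz big_cat. Qed.

Lemma szJ u v : (sz u v)^* = sz v u.
Proof.
rewrite /sz exchange_big /= rmorph_sum /=; apply: eq_bigr => b _.
rewrite rmorph_sum /=; apply: eq_bigr => a _.
by rewrite 2!conjM conjCK szkJ [b.2 * _]mulrC.
Qed.

Lemma sz_catr u v v' : sz u (v ++ v') = sz u v + sz u v'.
Proof. by rewrite -szJ sz_catl conjD !szJ. Qed.

Lemma wt_cat g u v : wt g (u ++ v) = wt g u ++ wt g v.
Proof. exact: map_cat. Qed.

Lemma wt_comp g h u : wt g (wt h u) = wt (fun z => g z * h z) u.
Proof. by rewrite /wt -map_comp; apply: eq_map => a /=; rewrite mulrA. Qed.

Lemma inDs_wt g u : inDs (wt g u) = inDs u.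
Proof. by rewrite /inDs all_map. Qed.

Lemma eq_in_wt g h u : (forall a, a \in u -> g a.1 * a.2 = h a.1 * a.2) ->
  wt g u = wt h u.
Proof. by move=> e; apply/eq_in_map => a /e ->. Qed.

Lemma sz_sclL c u v : sz (wt (fun=> c) u) v = c * sz u v.
Proof.
rewrite /sz big_map mulr_sumr; apply: eq_bigr => a _.
by rewrite mulr_sumr; apply: eq_bigr => b _ /=; rewrite -!mulrA.
Qed.

Lemma sz_sclR c u v : sz u (wt (fun=> c) v) = c^* * sz u v.
Proof. by rewrite -szJ sz_sclL conjM szJ. Qed.

Lemma sz_schur w u v : modc w < 1 -> inDs u -> inDs v ->
  sz u v = sz (wt (bf w) u) (wt (bf w) v)
    + (1 - w * w^*) * (sz u [:: (w, 1)] * sz [:: (w, 1)] v).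
Proof.
move=> hw hu hv.
have -> : sz u [:: (w, 1)] = \sum_(a <- u) a.2 * szk a.1 w.
  by apply: eq_bigr => a _; rewrite big_seq1 /= conj1 mulr1.
have -> : sz [:: (w, 1)] v = \sum_(b <- v) b.2^* * szk w b.1.
  by rewrite /sz big_seq1; apply: eq_bigr => b _; rewrite mul1r.
rewrite /sz big_map big_distrlr /= mulr_sumr -big_split /=.
rewrite big_seq [RHS]big_seq; apply: eq_bigr => a /(allP hu) ha.
rewrite big_map mulr_sumr -big_split /=.
rewrite big_seq [RHS]big_seq; apply: eq_bigr => b /(allP hv) hb.
rewrite {1}(szk_schur hw ha hb) conjM; ring.
Qed.

Lemma rc_sq u : rc (sq u) = sz u u.
Proof. by rewrite /sq RRe_real //; apply/CrealP; rewrite szJ. Qed.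

Lemma sq_schur w u : modc w < 1 -> inDs u ->
  sq u = sq (wt (bf w) u) + (1 - modc w ^+ 2) * modc (sz u [:: (w, 1)]) ^+ 2.
Proof.
move=> hw hu; apply: complexI.
rewrite rmorphD rmorphM rmorphB rmorph1 /= !modc_sqrC !rc_sq szJ.
exact: sz_schur.
Qed.

Lemma sz_filter0 (P : pred (C * C)) u v :
  (forall a, a \in u -> ~~ P a -> a.2 = 0) -> sz u v = sz (filter P u) v.
Proof.
move=> h; rewrite /sz big_filter [RHS]big_mkcond big_seq [RHS]big_seq.
apply: eq_bigr => a au; case: ifP => // /negbT /(h a au) ->.
by apply: big1 => b _; rewrite !mul0r.
Qed.

Lemma sq_filter0 (P : pred (C * C)) u :
  (forall a, a \in u -> ~~ P a -> a.2 = 0) -> sq u = sq (filter P u).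
Proof. by move=> h; apply: complexI; rewrite !rc_sq (sz_filter0 _ h) -szJ (sz_filter0 _ h) szJ. Qed.

Lemma bf_self w : bf w w = 0. Proof. by rewrite /bf subrr mul0r. Qed.

Lemma bf_neq0 w z : modc w < 1 -> modc z < 1 -> z != w -> bf w z != 0.
Proof.
by move=> hw hz ne; rewrite mulf_neq0 ?invr_eq0 ?subr_eq0 //; rewrite -subr_eq0; exact: sub1_neq0'.
Qed.

(** Pivoting at the first point w splits off a square, and the factor [bf w] annihilates the weight
    at w, so the remaining list is shorter. *)
Lemma sq_ge0 u : inDs u -> 0 <= sq u.
Proof.
move: {2}(size u) (leqnn (size u)) => n; elim: n u => [|n IH] u.
  by rewrite leqn0 size_eq0 => /eqP -> _; rewrite /sq sz_nill.
case: u => [|[w c] u]; first by rewrite /sq sz_nill.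
move=> su hu; have hw : modc w < 1 by case/andP: hu.
rewrite (sq_schur hw hu); apply: addr_ge0; last first.
  apply: mulr_ge0; last exact: sqr_ge0.
  by have := modc_ge0 w; rewrite subr_ge0 expr_le1 ?modc_ge0 // ltW.
rewrite (sq_filter0 (P := fun a => a.1 != w)); last first.
  by move=> _ /mapP[a _ ->] /=; rewrite negbK => /eqP ->; rewrite bf_self mul0r.
apply: IH.
  rewrite /= eqxx /=; apply: leq_trans (_ : size u <= n)%N; last exact: su.
  by rewrite size_filter (leq_trans (count_size _ _)) ?size_map.
by rewrite /inDs all_filter; apply/allP => a /mapP[b bu ->] /=; apply/implyP => _; apply: (allP hu).
Qed.

Lemma sq_scl c u : sq (wt (fun=> c) u) = modc c ^+ 2 * sq u.
Proof.
by apply: complexI; rewrite rmorphM /= modc_sqrC !rc_sq sz_sclL sz_sclR mulrA.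
Qed.

Lemma sq_cat u v : sq (u ++ v) = sq u + sq v + 2 * complex.Re (sz u v).
Proof.
have ReD (x y : C) : complex.Re (x + y) = complex.Re x + complex.Re y.
  by case: x; case: y.
rewrite /sq sz_catl !sz_catr !ReD.
have -> : complex.Re (sz v u) = complex.Re (sz u v).
  by rewrite -szJ; case: (sz u v).
lra.
Qed.

Lemma sq_bf_le w u : modc w < 1 -> inDs u -> sq (wt (bf w) u) <= sq u.
Proof.
move=> hw hu; rewrite (sq_schur hw hu) lerDl mulr_ge0 ?sqr_ge0 //.
by rewrite subr_ge0 expr_le1 ?modc_ge0 // ltW.
Qed.

(** Positivity of [sq] on the combinations t u + v and t u - v. *)
Lemma sz_young (t : R) u v : 0 < t -> inDs u -> inDs v ->
  2 * `|complex.Re (sz u v)| <= t * sq u + sq v / t.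
Proof.
move=> t0 hu hv.
have key (s : R) : 0 <= t ^+ 2 * sq u + s ^+ 2 * sq v + 2 * (t * s * complex.Re (sz u v)).
  have : 0 <= sq (wt (fun=> rc t) u ++ wt (fun=> rc s) v).
    by apply: sq_ge0; rewrite /inDs all_cat -!/(inDs _) !inDs_wt hu hv.
  rewrite sq_cat !sq_scl !modc_real !real_normK ?num_real // sz_sclL sz_sclR.
  rewrite (_ : complex.Re _ = t * s * complex.Re (sz u v)) //.
  case: (sz u v) => a b /=; rewrite !(mul0r, mulr0, oppr0, subr0, addr0, add0r).
  by rewrite mulrA.
have k1 := key 1; have k2 := key (-1).
rewrite sqrrN expr1n !mul1r !mulr1 in k1 k2; rewrite !mulrN1 in k2.
have : t * (2 * `|complex.Re (sz u v)|) <= t * (t * sq u + sq v / t).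
  have -> : t * (t * sq u + sq v / t) = t ^+ 2 * sq u + sq v.
    by field; rewrite gt_eqF.
  case: ger0P => _; lra.
by rewrite ler_pM2l.
Qed.

End Szego.

(** * Pick's theorem: Schur functions are contractive multipliers *)

Section Pick.
Variable R : realType.
Local Notation C := (R[i]).
Local Notation rc := (real_complex R).

Lemma pseudohyp (z w : C) :
  modc (1 - w^* * z) ^+ 2 - modc (z - w) ^+ 2 = (1 - modc z ^+ 2) * (1 - modc w ^+ 2).
Proof.
apply: complexI; rewrite rmorphM !rmorphB rmorph1 /= !modc_sqrC.
by rewrite !conjE; ring.
Qed.

Lemma pseudohyp_le (z w : C) : modc z <= 1 -> modc w <= 1 ->
  modc (z - w) <= modc (1 - w^* * z).
Proof.
move=> hz hw; rewrite -(ler_pXn2r (n := 2)) ?nnegrE ?modc_ge0 // -subr_ge0 pseudohyp.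
by rewrite mulr_ge0 // subr_ge0 expr_le1 ?modc_ge0.
Qed.

(** [E] collects the earlier pivots, at which the quotients of Schur's algorithm only have the
    default value of a division by 0. *)
Definition schur_off (E : seq C) (S : C -> C) : Prop :=
  (forall z, modc z < 1 -> z \notin E -> cdiff S z) /\
  (forall z, modc z < 1 -> z \notin E -> modc (S z) <= 1).

(* Schwarz's lemma: the quotient is bounded near [w] because [S] is differentiable
   there, and its modulus is asymptotically at most 1 near the unit circle. *)
Lemma schur_step (S : C -> C) (E : seq C) (w : C) (r : R) :
  modc w < 1 -> w \notin E -> 0 <= r < 1 ->
  (forall z, modc z < 1 -> z \notin E -> cdiff S z) ->
  (forall z, modc z < 1 -> z \notin E -> modc (S z) <= r) ->
  schur_off (w :: E) (fun z => (S z - S w) / ((1 - (S w)^* * S z) * bf w z)).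
Proof.
move=> w1 wE /andP[r0 r1] dS bS; have w0 := modc_ge0 w.
have bw := bS _ w1 wE; set s := S w in bw *.
(* The strict bound r < 1 keeps the Moebius denominator away from 0. *)
have th z : modc z < 1 -> z \notin E -> 1 - r <= modc (1 - s^* * S z).
  move=> z1 zE; have := modc_subge 1 (s^* * S z); rewrite modc1 modcM modcJ.
  have : modc s * modc (S z) <= r * 1.
    by apply: ler_pM; rewrite ?modc_ge0 //; have := bS _ z1 zE; lra.
  lra.
have th0 z : modc z < 1 -> z \notin E -> 1 - s^* * S z != 0.
  by move=> z1 zE; rewrite -modc_gt0; have := th _ z1 zE; lra.
have dS1 z : modc z < 1 -> z \notin w :: E ->
    cdiff (fun z => (S z - s) / ((1 - s^* * S z) * bf w z)) z.
  move=> z1; rewrite inE negb_or => /andP[zw zE].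
  have dz := dS _ z1 zE.
  apply: cdiffM; first by apply: cdiffD => //; exact: cdiff_cst.
  apply: (cdiffV (f := fun z => (1 - s^* * S z) * bf w z)).
    by rewrite mulf_neq0 ?th0 // bf_neq0.
  apply: cdiffM.
    rewrite (_ : (fun _ => _) = (fun z => 1 + (- s^*) * S z)); last first.
      by apply/funext => x; rewrite mulNr.
    by apply: cdiffD; [exact: cdiff_cst|apply: cdiffM => //; exact: cdiff_cst].
  apply: cdiffM; first by apply: cdiffD; [exact: cdiff_id|exact: cdiff_cst].
  apply: (cdiffV (f := fun z => 1 - w^* * z)); first exact: sub1_neq0'.
  rewrite (_ : (fun _ => _) = (fun z => 1 + (- w^*) * z)); last first.
    by apply/funext => x; rewrite mulNr.
  apply: cdiffD; first exact: cdiff_cst.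
  by apply: cdiffM; [exact: cdiff_cst|exact: cdiff_id].
have S1E z : (S z - s) / ((1 - s^* * S z) * bf w z) =
    (S z - s) * (1 - w^* * z) / ((1 - s^* * S z) * (z - w)).
  by rewrite /bf !invfM !invrK; ring.
have mS1 z : modc ((S z - s) / ((1 - s^* * S z) * bf w z)) =
    modc (S z - s) * modc (1 - w^* * z) / (modc (1 - s^* * S z) * modc (z - w)).
  by rewrite S1E !modcM modcV !modcM.
split=> //.
have [K hK] : exists K, forall z, modc z < 1 -> z \notin w :: E ->
    modc ((S z - s) / ((1 - s^* * S z) * bf w z)) <= K.
  have /cdiffP[ph [cph [rh rh0 hph]]] := dS _ w1 wE.
  have [rb rb0 [Kp hKp]] := ccont_bounded cph.
  pose rr := Num.min rh rb.
  have rr0 : 0 < rr by rewrite lt_min rh0.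
  (* Near w the zero of S - S(w) cancels z - w, leaving the bounded difference quotient; elsewhere
     |z - w| >= rr. *)
  pose K := Num.max (Kp * 2 / (1 - r)) (2 * 2 / ((1 - r) * rr)).
  have Kp0 : 0 <= Kp.
    by apply: le_trans (modc_ge0 _) (hKp w _); rewrite subrr modc0.
  exists K => z z1; rewrite inE negb_or => /andP[zw zE]; rewrite mS1 le_max.
  have hz := th _ z1 zE.
  have zw0 : 0 < modc (z - w) by rewrite modc_gt0 subr_eq0.
  have th1 : 0 < modc (1 - s^* * S z) by lra.
  have two : modc (1 - w^* * z) <= 2.
    have := modcB 1 (w^* * z); rewrite modc1 modcM modcJ.
    have : modc w * modc z <= 1 * 1 by apply: ler_pM; rewrite ?modc_ge0 ?ltW.
    lra.
  have [lt|ge] := ltP (modc (z - w)) rr; apply/orP; [left|right].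
    move: (lt); rewrite lt_min => /andP[l1 l2].
    rewrite (hph _ l1) modcM ler_pdivrMr ?mulr_gt0 //.
    have -> : Kp * 2 / (1 - r) * (modc (1 - s^* * S z) * modc (z - w)) =
       (Kp * modc (z - w) * 2) * (modc (1 - s^* * S z) / (1 - r)) by ring.
    have q1 : 1 <= modc (1 - s^* * S z) / (1 - r) by rewrite ler_pdivlMr ?mul1r //; lra.
    apply: le_trans (_ : Kp * modc (z - w) * 2 <= _); last first.
      by rewrite ler_peMr // mulr_ge0 // mulr_ge0 // modc_ge0.
    apply: ler_pM => //; rewrite ?mulr_ge0 ?modc_ge0 //.
    by apply: ler_wpM2r; rewrite ?modc_ge0 // hKp.
  have Ss : modc (S z - s) <= 2 by have := modcB (S z) s; have := bS _ z1 zE; lra.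
  apply: ler_pM; rewrite ?mulr_ge0 ?invr_ge0 ?mulr_ge0 ?modc_ge0 //.
    by apply: ler_pM; rewrite ?modc_ge0.
  rewrite lef_pV2 ?posrE ?mulr_gt0 //; last by lra.
  by apply: ler_pM => //; lra.
apply: (max_principle dS1 hK) => e e0.
pose d := (1 - modc w) / 2; have d0 : 0 < d by rewrite /d; lra.
(* The first radius gives |z - w| >= d. With the second, [pseudohyp] gives |1 - conj(w) z|^2 <= |z -
   w|^2 + 2 e d^2 <= (1 + e)^2 |z - w|^2. *)
exists (Num.max ((1 + modc w) / 2) (1 - e * d ^+ 2)).
  rewrite gt_max; apply/andP; split; first by lra.
  by have : 0 < e * d ^+ 2; [rewrite mulr_gt0 // exprn_gt0|lra].
move=> z; rewrite gt_max => /andP[/andP[za zb] z1]; rewrite inE negb_or => /andP[zw zE].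
have hz := th _ z1 zE.
have zw0 : 0 < modc (z - w) by rewrite modc_gt0 subr_eq0.
have th1 : 0 < modc (1 - s^* * S z) by lra.
rewrite mS1 ler_pdivrMr ?mulr_gt0 // mulrC [X in _ <= _ * X]mulrC mulrA.
have zd : d <= modc (z - w) by have := modc_subge z w; rewrite /d; lra.
apply: ler_pM; rewrite ?modc_ge0 //; last first.
  by apply: pseudohyp_le; [have := bS _ z1 zE|]; lra.
rewrite -(ler_pXn2r (n := 2)) ?nnegrE ?modc_ge0 //; last first.
  by rewrite mulr_ge0 ?modc_ge0 //; lra.
have ph := pseudohyp z w.
have z0 := modc_ge0 z.
have p1 : (1 - modc z ^+ 2) * (1 - modc w ^+ 2) <= 2 * (1 - modc z) * 1.
  have w2 : 0 <= 1 - modc w ^+ 2 <= 1.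
    by rewrite subr_ge0 expr_le1 ?modc_ge0 ?(ltW w1) //= gerBl sqr_ge0.
  have z2 : 0 <= 1 - modc z ^+ 2 by rewrite subr_ge0 expr_le1 ?modc_ge0 ?(ltW z1).
  by case/andP: w2 => *; apply: ler_pM => //; have := sqr_ge0 (1 - modc z); lra.
have dd : d ^+ 2 <= modc (z - w) ^+ 2 by rewrite ler_pXn2r ?nnegrE ?modc_ge0 // ltW.
have p2 := ler_wpM2l (ltW e0) dd.
have p3 : 0 <= e ^+ 2 * modc (z - w) ^+ 2 by rewrite mulr_ge0 ?sqr_ge0.
lra.
Qed.

(** Termwise this is (1 - |s|^2)(1 - T(z) conj(T(y))) = (1 - conj(s) T(z))(1 - s conj(T(y))) - (T(z)
    - s)(conj(T(y)) - conj(s)). *)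
Lemma sq_mobius (T : C -> C) (s : C) v :
  (1 - modc s ^+ 2) * (sq v - sq (wt T v)) =
  sq (wt (fun z => 1 - s^* * T z) v) - sq (wt (fun z => T z - s) v).
Proof.
apply: complexI; rewrite rmorphM !rmorphB rmorph1 /= modc_sqrC !rc_sq.
rewrite /sz !big_map -!sumrB mulr_sumr; apply: eq_bigr => a _.
rewrite !big_map -!sumrB mulr_sumr; apply: eq_bigr => b _ /=.
by rewrite !conjE; ring.
Qed.

(** Induction on the number of points, with [S] and [E] varying. The Moebius map sending S(w) to 0
    kills the entry at w; division by [bf w] gives the function for the remaining points, and w
    joins [E]. *)
Lemma pick_positive_off u (S : C -> C) (E : seq C) : schur_off E S ->
  inDs u -> all (fun a => a.1 \notin E) u -> sq (wt S u) <= sq u.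
Proof.
move: {2}(size u) (leqnn (size u)) => n.
elim: n u S E => [|n IH] u S E.
  by rewrite leqn0 size_eq0 => /eqP -> _ _ _; rewrite /sq !sz_nill.
case: u => [|[w c] u]; first by rewrite /sq !sz_nill.
set v := (w, c) :: u => su [dS bS] hv vE.
have w1 : modc w < 1 by case/andP: hv.
have wE : w \notin E by case/andP: vE.
(* [schur_step] needs a bound below 1, hence the scaling of [S] by r. *)
have scaled (r : R) : 0 <= r < 1 -> r ^+ 2 * sq (wt S v) <= sq v.
  move=> hr; pose T z := rc r * S z.
  have -> : r ^+ 2 * sq (wt S v) = sq (wt T v).
    have -> : wt T v = wt (fun=> rc r) (wt S v) by rewrite wt_comp.
    by rewrite sq_scl modc_real real_normK ?num_real.
  have dT z : modc z < 1 -> z \notin E -> cdiff T z.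
    by move=> z1 zE; apply: cdiffM; [exact: cdiff_cst|exact: dS].
  have bT z : modc z < 1 -> z \notin E -> modc (T z) <= r.
    case/andP: hr => r0 r1.
    move=> z1 zE; rewrite modcM modc_real ger0_norm // ler_piMr //; exact: bS.
  have step := schur_step w1 wE hr dT bT.
  set s := T w in step; set S1 := (fun z => _) in step.
  have bs : modc s <= r by apply: bT.
  pose th z := 1 - s^* * T z.
  have th0 z : modc z < 1 -> z \notin E -> th z != 0.
    move=> z1 zE; case/andP: hr => r0 r1.
    rewrite -modc_gt0; have := modc_subge 1 (s^* * T z); rewrite modc1 modcM modcJ.
    have : modc s * modc (T z) <= r * 1.
      by apply: ler_pM; rewrite ?modc_ge0 //; have := bT _ z1 zE; lra.
    by rewrite /th; lra.
  have cpos : 0 < 1 - modc s ^+ 2.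
    have s0 := modc_ge0 s.
    have : modc s * modc s <= r * 1 by apply: ler_pM => //; lra.
    by rewrite expr2; lra.
  have eqc : (1 - modc s ^+ 2) * (sq v - sq (wt T v)) =
      sq (wt th v) - sq (wt (fun z => T z - s) v).
    exact: sq_mobius.
  rewrite -subr_ge0 -(pmulr_rge0 _ cpos) eqc subr_ge0.
  apply: le_trans (sq_bf_le w1 (_ : inDs (wt th v))); last by rewrite inDs_wt.
  rewrite wt_comp.
  pose x := filter (fun a => a.1 != w) (wt (fun z => bf w z * th z) v).
  have -> : sq (wt (fun z => bf w z * th z) v) = sq x.
    apply: sq_filter0 => _ /mapP[a _ ->] /=; rewrite negbK => /eqP ->.
    by rewrite bf_self !mul0r.
  have -> : sq (wt (fun z => T z - s) v) = sq (wt S1 x).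
    rewrite (sq_filter0 (P := fun a => a.1 != w)); last first.
      by move=> _ /mapP[a _ ->] /=; rewrite negbK => /eqP ->; rewrite subrr mul0r.
    congr sq; rewrite /x /wt !filter_map -map_comp.
    apply/eq_in_map => a; rewrite mem_filter /= => /andP[aw av]; congr (_, _).
    have a1 := allP hv _ av; have aE := allP vE _ av.
    rewrite /S1 -/(th _); field.
    by rewrite th0 // bf_neq0.
  apply: (IH x S1 (w :: E) _ step).
  - rewrite /x /= eqxx /=; apply: leq_trans (_ : size u <= n)%N; last exact: su.
    by rewrite size_filter (leq_trans (count_size _ _)) ?size_map.
  - rewrite /inDs all_filter; apply/allP => a /mapP[b bu ->] /=.
    by apply/implyP => _; apply: (allP hv).
  - rewrite all_filter; apply/allP => a /mapP[b bu ->] /=; apply/implyP => ne.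
    by rewrite inE negb_or ne /=; apply: (allP vE).
rewrite leNgt; apply/negP => lt.
have v0 := sq_ge0 hv.
have Sp : 0 < sq (wt S v) by lra.
(* The value of r^2: halfway between 1 and the ratio, which is below 1 if the claim fails. *)
pose x := (sq v / sq (wt S v) + 1) / 2.
have q1 : sq v / sq (wt S v) < 1 by rewrite ltr_pdivrMr // mul1r.
have q0 : 0 <= sq v / sq (wt S v) by rewrite divr_ge0 // ltW.
have qe : sq v / sq (wt S v) * sq (wt S v) = sq v by rewrite divfK // gt_eqF.
have hr : 0 <= Num.sqrt x < 1.
  by rewrite sqrtr_ge0 -sqrtr1 ltr_sqrt //; rewrite /x; lra.
have := scaled _ hr; rewrite sqr_sqrtr; last by rewrite /x; lra.
have : (1 - sq v / sq (wt S v)) * sq (wt S v) > 0 by rewrite mulr_gt0 //; lra.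
by rewrite /x; lra.
Qed.

Definition contractive (S : C -> C) := forall u, inDs u -> sq (wt S u) <= sq u.

Lemma schur_contractive (S : C -> C) : schur S -> contractive S.
Proof.
move=> [hol bd] u hu; apply: (pick_positive_off (E := [::])) => //; last exact/allP.
split=> z z1 _; last first.
  by rewrite -(modc1 R) -lecR -!normcE_modc normr1; apply: bd; apply/inD_modc.
have [d hd] := hol z (proj2 (inD_modc z) z1).
exists d => e e0.
have [|del [del0 hdel]] := hd (rc e); first by rewrite ltcR.
have delE : del = rc (modc del) by rewrite -normcE_modc gtr0_norm.
(* The second radius keeps w in the disc, where [holomorphic_on_D] speaks. *)
exists (Num.min (modc del) (1 - modc z)).
  by rewrite lt_min subr_gt0 z1 andbT modc_gt0 gt_eqF.
move=> w; rewrite lt_min => /andP[h1 h2].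
have [->|ne] := eqVneq w z; first by rewrite !subrr mulr0 subrr modc0 mulr0.
have nz : w - z != 0 by rewrite subr_eq0.
have wz0 : 0 < modc (w - z) by rewrite modc_gt0.
have w1 : modc w < 1 by have := modc_subge w z; lra.
have := hdel w (proj2 (inD_modc w) w1).
rewrite normr_gt0 nz delE normcE_modc ltcR h1 => /(_ isT).
rewrite normcE_modc ltcR => /ltW h.
have -> : S w - S z - d * (w - z) = ((S w - S z) / (w - z) - d) * (w - z) by field.
by rewrite modcM ler_wpM2r // ltW.
Qed.

End Pick.

(** * Negative eigenvalues of Hermitian matrices *)

Section Inertia.
Variable R : realType.
Local Notation C := (R[i]).
Local Open Scope sesquilinear_scope.

Lemma proots_prod_XsubC (s : seq C) :
  perm_eq (proots (\prod_(x <- s) ('X - x%:P))) s.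
Proof.
rewrite /proots; case: closed_field_poly_normal => r /=.
rewrite lead_coef_prod_XsubC scale1r => e; apply/allP => x _ /=.
by rewrite -!mu_prod_XsubC e.
Qed.

Lemma char_poly_similar n (A P D : 'M[C]_n) : P \in unitmx ->
  A = invmx P *m D *m P -> char_poly A = char_poly D.
Proof.
move=> uP ->; rewrite /char_poly /char_poly_mx.
have PV : map_mx polyC (invmx P) *m map_mx polyC P = 1%:M.
  by rewrite -map_mxM mulVmx // map_mx1.
have -> : 'X%:M - map_mx polyC (invmx P *m D *m P) =
    map_mx polyC (invmx P) *m ('X%:M - map_mx polyC D) *m map_mx polyC P.
  by rewrite mulmxBr mulmxBl scalar_mxC -['X%:M *m _ *m _]mulmxA PV mulmx1 !map_mxM.
by rewrite !det_mulmx mulrAC -det_mulmx PV det1 mul1r.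
Qed.

Lemma sqm_spectral n (A : 'M[C]_n) : A \is hermsymmx ->
  sqm A = #|[pred i | spectral_diag A 0 i < 0]|.
Proof.
move=> /hermitian_normalmx /orthomx_spectralP e; rewrite /sqm.
rewrite (char_poly_similar (spectral_unit A) e) char_poly_trig; last first.
  exact/diag_mx_is_trig.
have -> : \prod_(i < n) ('X - (diag_mx (spectral_diag A) i i)%:P) =
    \prod_(x <- [seq spectral_diag A 0 i | i : 'I_n]) ('X - x%:P).
  by rewrite big_image /=; apply: eq_bigr => i _; rewrite !mxE eqxx mulr1n.
rewrite (permP (proots_prod_XsubC _)) count_map cardE /enum_mem size_filter.
by rewrite count_filter; apply: eq_count => i; rewrite /= inE andbT.
Qed.

Definition hform n (A : 'M[C]_n) (x : 'rV[C]_n) : C :=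
  \sum_i \sum_j x 0 i * (x 0 j)^* * A i j.

Lemma hform_spectral n (A : 'M[C]_n) (x : 'rV[C]_n) : A \is hermsymmx ->
  let y := x *m (spectralmx A)^t* in
  hform A x = \sum_i spectral_diag A 0 i * `|y 0 i| ^+ 2.
Proof.
move=> /hermitian_normalmx /orthomx_spectralP e y.
have -> : hform A x = (x *m A *m x^t*) 0 0.
  rewrite mxE /hform exchange_big /=; apply: eq_bigr => j _.
  rewrite !mxE mulr_suml; apply: eq_bigr => i _.
  by rewrite mulrAC.
have -> : x *m A *m x^t* = y *m diag_mx (spectral_diag A) *m y^t*.
  rewrite {1}e invmx_unitary ?spectral_unitarymx // /y.
  by rewrite trmx_mul map_mxM trmxCK !mulmxA.
rewrite mxE; apply: eq_bigr => i _.
by rewrite mul_mx_diag !mxE normCK; ring.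
Qed.

Lemma ker_exists m k (M : 'M[C]_(m, k)) : (k < m)%N ->
  exists2 y : 'rV[C]_m, y != 0 & y *m M = 0.
Proof.
move=> km; have : kermx M != 0.
  rewrite kermx_eq0 /row_free; apply/eqP => e.
  by have := rank_leq_col M; rewrite e leqNgt km.
move=> /rowV0Pn[y ys y0]; exists y => //; exact/sub_kermxP.
Qed.

Lemma diag_real n (A : 'M[C]_n) i : A \is hermsymmx ->
  ~~ (spectral_diag A 0 i < 0) -> 0 <= spectral_diag A 0 i.
Proof.
move=> hA; have /mxOverP /(_ 0 i) r := hermitian_spectral_diag_real hA.
by rewrite -real_leNgt.
Qed.

(** With more than k negative eigenvalues, the span of their eigenvectors would meet the kernel of
    [M], of codimension at most k, in a non-zero vector. *)
Lemma sqm_le n k (A : 'M[C]_n) (M : 'M[C]_(n, k)) : A \is hermsymmx ->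
  (forall x : 'rV[C]_n, x *m M = 0 -> 0 <= hform A x) -> (sqm A <= k)%N.
Proof.
move=> hA pos; rewrite sqm_spectral // leqNgt; apply/negP => lt.
set N := [pred i | _] in lt; pose f (a : 'I_#|N|) : 'I_n := enum_val a.
have fN a : spectral_diag A 0 (f a) < 0 by have := enum_valP a; rewrite inE.
pose E := rowsub f (spectralmx A).
have [y y0 yE] := ker_exists (E *m M) lt.
have := pos (y *m E); rewrite -mulmxA => /(_ yE).
rewrite hform_spectral //= -mulmxA mul_rowsub_mx.
rewrite (unitarymxP (spectral_unitarymx A)).
set c := y *m _ => h.
have cE j : c 0 j = \sum_a y 0 a * (f a == j)%:R.
  by rewrite mxE; apply: eq_bigr => a _; rewrite !mxE.
have cf a : c 0 (f a) = y 0 a.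
  rewrite cE (bigD1 a) //= eqxx mulr1 big1 ?addr0 // => b ba.
  by rewrite (inj_eq enum_val_inj) (negbTE ba) mulr0.
have c0 j : ~~ (spectral_diag A 0 j < 0) -> c 0 j = 0.
  move=> nj; rewrite cE big1 // => a _.
  by case: eqP => [e|_]; [rewrite -e fN in nj|rewrite mulr0].
have [a ya] : exists a, y 0 a != 0.
  apply/existsP; apply: contra_neqT y0; rewrite negb_exists => /forallP z.
  by apply/rowP => a; rewrite mxE; apply/eqP; have := z a; rewrite negbK.
have : \sum_i spectral_diag A 0 i * `|c 0 i| ^+ 2 < 0.
  rewrite (bigD1 (f a)) //=; apply: ltr_wnDr; last first.
    by rewrite nmulr_rlt0 ?fN // exprn_gt0 // normr_gt0 cf.
  apply: sumr_le0 => j _; have [dj|/c0 ->] := boolP (spectral_diag A 0 j < 0).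
    by rewrite nmulr_rle0 // exprn_ge0.
  by rewrite normr0 expr0n mulr0.
by move=> /(le_lt_trans h); rewrite ltxx.
Qed.

(** With fewer than k negative eigenvalues, some non-trivial combination of the rows of [V] would be
    orthogonal to all their eigenvectors, and the form is non-negative there. *)
Lemma sqm_ge n k (A : 'M[C]_n) (V : 'M[C]_(k, n)) : A \is hermsymmx ->
  (forall x : 'rV[C]_k, x != 0 -> hform A (x *m V) < 0) -> (k <= sqm A)%N.
Proof.
move=> hA neg; rewrite sqm_spectral // leqNgt; apply/negP => lt.
set N := [pred i | _] in lt; pose f (a : 'I_#|N|) : 'I_n := enum_val a.
have [x x0 xE] := ker_exists (colsub f (V *m (spectralmx A)^t*)) lt.
have := neg x x0; rewrite hform_spectral //= -mulmxA => h.
have c0 j : spectral_diag A 0 j < 0 -> (x *m (V *m (spectralmx A)^t*)) 0 j = 0.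
  move=> dj; have jN : j \in N by rewrite inE.
  have /rowP /(_ (enum_rank_in jN j)) := xE.
  by rewrite mulmx_colsub [LHS]mxE [RHS]mxE /f enum_rankK_in.
have : 0 <= \sum_i spectral_diag A 0 i * `|(x *m (V *m (spectralmx A)^t*)) 0 i| ^+ 2.
  apply: sumr_ge0 => j _; have [/c0 ->|dj] := boolP (spectral_diag A 0 j < 0).
    by rewrite normr0 expr0n mulr0.
  by rewrite mulr_ge0 ?exprn_ge0 // diag_real.
by move=> /le_lt_trans /(_ h); rewrite ltxx.
Qed.

Lemma pick_mx_hermitian (f : C -> C) n (z : 'I_n -> C) : pick_mx f z \is hermsymmx.
Proof.
apply/is_hermitianmxP; rewrite expr0 scale1r; apply/matrixP => i j; rewrite !mxE.
by rewrite !conjE [(f (z j))^* * _]mulrC [(z j)^* * _]mulrC.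
Qed.

End Inertia.

(** * Factorisation of a rational Blaschke product *)

Section Blaschke.
Variable R : realType.
Local Notation C := (R[i]).

Definition bl (ws : seq C) (z : C) : C := \prod_(w <- ws) bf w z.

Lemma normc_lt1 (z : C) : (`|z| < 1) = (modc z < 1).
Proof. by rewrite -(modc1 R) modc_lt normr1. Qed.

Lemma normc_le1 (z : C) : (`|z| <= 1) = (modc z <= 1).
Proof. by rewrite normcE_modc -(lecR _ 1). Qed.

Lemma normc_eq1 (z : C) : `|z| = 1 <-> modc z = 1.
Proof.
by rewrite normcE_modc; split=> [|->//]; move=> e; apply: complexI.
Qed.

(** The conjugate reciprocal polynomial: on the unit circle its value is z^(n-1) conj(u(z)). *)
Definition revp n (u : {poly C}) : {poly C} := \poly_(i < n) (u`_(n.-1 - i))^*.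

Lemma revp_horner n (u : {poly C}) x : (size u <= n)%N -> x != 0 ->
  (revp n u).[x] = x ^+ n.-1 * (u.[(x^*)^-1])^*.
Proof.
case: n => [|n] su x0.
  rewrite (eqP (_ : u == 0)) -?size_poly_eq0 -?leqn0 // horner0.
  by rewrite /revp horner_poly big_ord0 rmorph0 mulr0.
rewrite (horner_coef_wide _ su) /revp horner_poly rmorph_sum mulr_sumr /=.
rewrite (reindex_inj rev_ord_inj) /=; apply: eq_bigr => i _.
have le : (i <= n)%N by rewrite -ltnS.
rewrite subSS subKn // conjM rmorphXn /= conjV conjCK mulrCA; congr (_ * _).
rewrite exprVn -[X in x ^+ X * _](subnK le) exprD -mulrA divff ?mulr1 //.
by rewrite expf_neq0.
Qed.

Lemma poly_eq_circle (p q : {poly C}) :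
  (forall z, modc z = 1 -> p.[z] = q.[z]) -> p = q.
Proof.
move=> e; apply/eqP; rewrite -subr_eq0; apply/eqP.
pose rs := [seq qcirc (k%:R : R) | k <- iota 0 (size (p - q))].
apply: (@roots_geq_poly_eq0 _ _ rs).
- apply/allP => _ /mapP[k _ ->]; apply/rootP.
  by rewrite hornerD hornerN e ?subrr // modc_qcirc.
- rewrite map_inj_uniq ?iota_uniq // => i j /qcirc_inj /eqP.
  by rewrite eqr_nat => /eqP.
- by rewrite size_map size_iota.
Qed.

Lemma conj_inv_circle (z : C) : modc z = 1 -> (z^*)^-1 = z.
Proof.
move=> z1; have z0 : z != 0 by rewrite -modc_gt0 z1.
apply: (mulIf (_ : z^* != 0)); first by rewrite conjC_eq0.
by rewrite mulVf ?conjC_eq0 // -modc_sqrC z1 expr1n rmorph1.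
Qed.

(** Equal moduli on the circle give u u# = v v#, where # denotes the conjugate reciprocal. A root x
    of u lies outside the closed disc, so 1 / conj(x) lies inside, where v has no root: u and v# are
    coprime. *)
Lemma dvdp_of_unimodular (u v : {poly C}) :
  (forall z, modc z <= 1 -> u.[z] != 0) -> (forall z, modc z <= 1 -> v.[z] != 0) ->
  (forall z, modc z = 1 -> modc u.[z] = modc v.[z]) -> u %| v.
Proof.
move=> u0 v0 uv; pose n := maxn (size u) (size v).
have su : (size u <= n)%N by rewrite leq_max leqnn.
have sv : (size v <= n)%N by rewrite leq_max leqnn orbT.
have e : u * revp n u = v * revp n v.
  apply: poly_eq_circle => z z1; have z0 : z != 0 by rewrite -modc_gt0 z1.
  rewrite !hornerM !revp_horner // conj_inv_circle // !(mulrCA _ (z ^+ _)).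
  by rewrite -!modc_sqrC uv.
have cop : coprimep u (revp n v).
  apply: Pdiv.ClosedField.root_coprimep => x /rootP ux.
  have x1 : 1 < modc x by rewrite ltNge; apply/negP => /u0; rewrite ux eqxx.
  have x0 : x != 0 by rewrite -modc_gt0; lra.
  rewrite revp_horner // mulf_neq0 ?expf_neq0 // conjC_eq0 v0 //.
  by rewrite modcV modcJ invf_le1 ?ltW //; lra.
by rewrite -(Gauss_dvdpl _ cop) -e dvdp_mulr.
Qed.

Lemma blaschke_prod (B : C -> C) d : blaschke B d -> exists c ws,
  [/\ modc c = 1, size ws = d, all (fun w => modc w < 1) ws &
      forall z, modc z < 1 -> B z = c * bl ws z].
Proof.
move=> [p [q [_ [q0 [BE [B1 ->]]]]]].
have {}q0 z : modc z <= 1 -> q.[z] != 0 by rewrite -normc_le1; apply: q0.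
have {}BE z : modc z <= 1 -> B z = p.[z] / q.[z] by rewrite -normc_le1; apply: BE.
have {}B1 z : modc z = 1 -> modc (B z) = 1 by move=> /normc_eq1 /B1 /normc_eq1.
have pE : p = lead_coef p *: \prod_(z <- proots p) ('X - z%:P).
  by rewrite /proots; case: closed_field_poly_normal.
set rs := proots p in pE *.
pose ws := [seq r <- rs | modc r < 1]; pose os := [seq r <- rs | ~~ (modc r < 1)].
(* Replacing each z - w, for a zero w in the disc, by 1 - conj(w) z keeps the modulus on the circle
   and removes the zeros of the numerator from the closed disc; so [u] is a constant times [q]. *)
pose u : {poly C} := lead_coef p *: (\prod_(r <- os) ('X - r%:P) *
   \prod_(w <- ws) (1 - w^* *: 'X)).
have uE z : u.[z] = lead_coef p * (\prod_(r <- os) (z - r) * \prod_(w <- ws) (1 - w^* * z)).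
  rewrite hornerZ hornerM !horner_prod; congr (_ * (_ * _)); apply: eq_bigr => r _.
    by rewrite hornerXsubC.
  by rewrite hornerD hornerN hornerZ hornerX hornerC.
have ppE z : p.[z] = lead_coef p * (\prod_(r <- os) (z - r) * \prod_(w <- ws) (z - w)).
  rewrite {1}pE hornerZ horner_prod /os /ws !big_filter; congr (_ * _).
  rewrite (bigID (fun r => modc r < 1)) /= mulrC.
  by congr (_ * _); apply: eq_bigr => r _; rewrite hornerXsubC.
have wsD : all (fun w => modc w < 1) ws by apply/allP => w; rewrite mem_filter => /andP[].
have den z : modc z <= 1 -> \prod_(w <- ws) (1 - w^* * z) != 0.
  move=> z1; rewrite prodf_seq_neq0; apply/allP => w /(allP wsD) w1 /=.
  rewrite -modc_gt0; apply: lt_le_trans (modc_subge _ _); rewrite modc1 modcM modcJ.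
  have : modc w * modc z <= modc w * 1 by rewrite ler_wpM2l ?modc_ge0.
  lra.
have p1 z : modc z = 1 -> p.[z] != 0.
  move=> z1; rewrite -modc_gt0; have := B1 _ z1; rewrite BE ?z1 // modcM modcV => e.
  have [h|h] := ltP 0 (modc p.[z]) => //.
  have z0 : modc p.[z] = 0 by apply/eqP; rewrite eq_le h modc_ge0.
  by move: e; rewrite z0 mul0r => /eqP; rewrite eq_sym oner_eq0.
have lc0 : lead_coef p != 0.
  by apply: contraNneq (p1 1 (modc1 R)); rewrite ppE => ->; rewrite mul0r.
have u0 z : modc z <= 1 -> u.[z] != 0.
  move=> z1; rewrite uE mulf_neq0 // mulf_neq0 ?den // prodf_seq_neq0.
  apply/allP => r; rewrite mem_filter -leNgt => /andP[r1 rrs] /=.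
  rewrite subr_eq0; apply/eqP => zr; rewrite zr in z1.
  have r11 : modc r = 1 by apply/eqP; rewrite eq_le z1 r1.
  have := p1 _ r11; rewrite pE hornerZ mulf_eq0 negb_or -rootE root_prod_XsubC rrs.
  by rewrite andbF.
have uv z : modc z = 1 -> modc u.[z] = modc q.[z].
  move=> z1; have := B1 _ z1; rewrite BE ?z1 // modcM modcV => e.
  have q1 : modc q.[z] != 0 by rewrite modc_eq0 q0 // z1.
  rewrite -[RHS]mul1r -e divfK // uE ppE !modcM !modc_prod; congr (_ * (_ * _)).
  apply: eq_bigr => w _; apply/eqP.
  rewrite -(eqrXn2 (n := 2)) ?modc_ge0 // -subr_eq0 pseudohyp z1 expr1n subrr.
  by rewrite mul0r.
have vu : u %= q.
  rewrite /eqp (dvdp_of_unimodular u0 q0 uv) /=.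
  by apply: dvdp_of_unimodular => // z z1; rewrite uv.
have [[c c'] /= /andP[c0 c0'] cE] := eqpP _ _ vu.
have ez z : c * u.[z] = c' * q.[z] by rewrite -!hornerZ cE.
exists (c' / c), ws; split=> //.
- have h1 : modc (1 : C) = 1 := modc1 R.
  have q1 : modc q.[1] != 0 by rewrite modc_eq0 q0 ?h1.
  have := congr1 (@modc R) (ez 1); rewrite modcM (modcM c') uv // => /(mulIf q1) e.
  by rewrite modcM modcV -e divff // modc_eq0.
- by rewrite /ws size_filter; apply: eq_count => r; rewrite /= normc_lt1.
move=> z z1; rewrite BE; last exact: ltW.
have qz : q.[z] != 0 by apply: q0; apply: ltW.
have e := ez z.
have -> : c' / c = u.[z] / q.[z].
  by apply: (mulfI c0); apply: (mulIf qz); rewrite mulrCA divff // mulr1 -e -!mulrA mulVf // mulr1.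
rewrite mulrAC; congr (_ / _); rewrite uE ppE.
have -> : bl ws z = \prod_(w <- ws) (z - w) / \prod_(w <- ws) (1 - w^* * z).
  by rewrite /bl /bf big_split /= prodfV.
have := den _ (ltW z1); set D := \prod_(w <- ws) (1 - w^* * z) => D0.
by field.
Qed.

Lemma bl_cons w ws z : bl (w :: ws) z = bf w z * bl ws z.
Proof. exact: big_cons. Qed.

Lemma bl_eq0 ws z : all (fun w => modc w < 1) ws -> modc z < 1 ->
  (bl ws z == 0) = (z \in ws).
Proof.
move=> hw hz; rewrite prodf_seq_eq0; apply/hasP/idP => [[w wws /= /eqP e]|zws].
  apply: contraTT (wws) => zn; apply/negP => _.
  have : bf w z != 0.
    by apply: bf_neq0 => //; [exact: (allP hw)|apply: contraNneq zn => ->].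
  by rewrite e eqxx.
by exists z => //=; rewrite bf_self.
Qed.

Lemma bl_contractive ws : all (fun w => modc w < 1) ws -> contractive (bl ws).
Proof.
elim: ws => [_|w ws IH /= /andP[w1 hws]] u hu.
  by rewrite (eq_in_wt (h := fun=> 1)) ?sq_scl ?modc1 ?expr1n ?mul1r // => a _; rewrite /bl big_nil.
have -> : wt (bl (w :: ws)) u = wt (bf w) (wt (bl ws) u).
  by rewrite wt_comp; apply: eq_in_wt => a _; rewrite bl_cons.
by apply: le_trans (sq_bf_le w1 _) (IH hws _ hu); rewrite inDs_wt.
Qed.

End Blaschke.

(** * Uniformly negative families for the Pick form of pairs *)

Section Negative.
Variable R : realType.
Local Notation C := (R[i]).
Local Notation rc := (real_complex R).
Implicit Types (u v : seq (C * C)) (x y : seq (C * C * C)).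

Lemma sz_cons a u v : sz (a :: u) v = sz [:: a] v + sz u v.
Proof. by rewrite -sz_catl. Qed.

Lemma sz_atom0 (w : C) v : sz [:: (w, 0)] v = 0.
Proof. by rewrite /sz big_seq1 big1 // => b _; rewrite !mul0r. Qed.

Lemma sz_atom (w c : C) v : sz [:: (w, c)] v = c * sz [:: (w, 1)] v.
Proof. by rewrite -sz_sclL /wt /= mulr1. Qed.

Lemma sq_eqv u v : (forall t, sz u t = sz v t) -> sq u = sq v.
Proof. by move=> e; apply: complexI; rewrite !rc_sq e -szJ e szJ. Qed.

Lemma sq_cons0 (w : C) u : sq ((w, 0) :: u) = sq u.
Proof. by apply: sq_eqv => t; rewrite sz_cons sz_atom0 add0r. Qed.

Definition sumsq (xs : seq C) : R := \sum_(c <- xs) modc c ^+ 2.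

Lemma sumsq_ge0 xs : 0 <= sumsq xs.
Proof. by apply: sumr_ge0 => c _; exact: sqr_ge0. Qed.

Lemma sumsq_cons c xs : sumsq (c :: xs) = modc c ^+ 2 + sumsq xs.
Proof. exact: big_cons. Qed.

Fixpoint comb2 (xs : seq C) (us : seq (seq (C * C))) : seq (C * C) :=
  match xs, us with
  | c :: xs', u :: us' => wt (fun=> c) u ++ comb2 xs' us'
  | _, _ => [::]
  end.

Lemma comb2_inD xs us : all (@inDs R) us -> inDs (comb2 xs us).
Proof.
elim: xs us => [|c xs IH] [|u us] //= /andP[hu hus].
by rewrite /inDs all_cat -!/(inDs _) inDs_wt hu IH.
Qed.

Lemma comb2_bound us : all (@inDs R) us -> exists2 K : R, 0 <= K &
  forall xs, sq (comb2 xs us) <= K * sumsq xs.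
Proof.
have nil0 : sq [::] = 0 :> R by rewrite /sq sz_nill.
elim: us => [_|u us IH /= /andP[hu hus]].
  by exists 0 => // -[|c xs]; rewrite nil0 mul0r.
have [K K0 hK] := IH hus; have u0 := sq_ge0 hu.
exists (2 * sq u + 2 * K); first by lra.
case=> [|c xs] /=; first by rewrite nil0 /sumsq big_nil mulr0.
have hc : inDs (wt (fun=> c) u) by rewrite inDs_wt.
have hx := comb2_inD xs hus.
have y1 := sz_young (ltr01 : 0 < 1 :> R) hc hx.
have y2 := ler_norm (complex.Re (sz (wt (fun=> c) u) (comb2 xs us))).
have h := hK xs; rewrite divr1 mul1r in y1.
rewrite sq_cat sumsq_cons; rewrite sq_scl in y1 *.
have s0 := sumsq_ge0 xs; have c0 := sqr_ge0 (modc c).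
have p1 := mulr_ge0 u0 s0; have p2 := mulr_ge0 K0 c0.
lra.
Qed.

(* A triple (z, b, s) stands for evaluating (b, s) at z on the pair of Szego
   spaces; the Pick form of the pair is the difference of the two squares. *)
Definition pb x : seq (C * C) := [seq a.1 | a <- x].
Definition ps x : seq (C * C) := [seq (a.1.1, a.2) | a <- x].
Definition pform x : R := sq (pb x) - sq (ps x).
Definition scl3 (c : C) x : seq (C * C * C) :=
  [seq (a.1.1, c * a.1.2, c * a.2) | a <- x].
Definition inD3 x := all (fun a : C * C * C => modc a.1.1 < 1) x.
(** One map for both pivots: the image of a multiple of (B, S) is a multiple of (B, b_w S) and, if
    b_w divides B, also of (B / b_w, S), with the weight multiplied by b_w. *)
Definition tau1 (w : C) (a : C * C * C) : C * C * C := (a.1.1, a.1.2, bf w a.1.1 * a.2).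
Definition tau w x := [seq tau1 w a | a <- x].

Fixpoint comb (xs : seq C) (us : seq (seq (C * C * C))) : seq (C * C * C) :=
  match xs, us with
  | c :: xs', u :: us' => scl3 c u ++ comb xs' us'
  | _, _ => [::]
  end.

Lemma pb_scl3 c x : pb (scl3 c x) = wt (fun=> c) (pb x).
Proof. by rewrite /pb /wt /scl3 -!map_comp. Qed.
Lemma ps_scl3 c x : ps (scl3 c x) = wt (fun=> c) (ps x).
Proof. by rewrite /ps /wt /scl3 -!map_comp. Qed.
Lemma pb_cat x y : pb (x ++ y) = pb x ++ pb y. Proof. exact: map_cat. Qed.
Lemma ps_cat x y : ps (x ++ y) = ps x ++ ps y. Proof. exact: map_cat. Qed.
Lemma inD3_pb x : inDs (pb x) = inD3 x. Proof. by rewrite /inDs all_map. Qed.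
Lemma inD3_ps x : inDs (ps x) = inD3 x. Proof. by rewrite /inDs all_map. Qed.
Lemma pb_tau w x : pb (tau w x) = pb x.
Proof. by rewrite /pb /tau -map_comp; apply: eq_map => -[[]]. Qed.
Lemma ps_tau w x : ps (tau w x) = wt (bf w) (ps x).
Proof. by rewrite /ps /tau /wt -!map_comp. Qed.

Lemma pb_comb xs us : pb (comb xs us) = comb2 xs [seq pb x | x <- us].
Proof. by elim: xs us => [|c xs IH] [|u us] //=; rewrite pb_cat pb_scl3 IH. Qed.
Lemma ps_comb xs us : ps (comb xs us) = comb2 xs [seq ps x | x <- us].
Proof. by elim: xs us => [|c xs IH] [|u us] //=; rewrite ps_cat ps_scl3 IH. Qed.

Lemma tau_comb w xs us : tau w (comb xs us) = comb xs [seq tau w x | x <- us].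
Proof.
elim: xs us => [|c xs IH] [|u us] //=; rewrite -IH /tau map_cat.
congr (_ ++ _); rewrite /scl3 -!map_comp; apply: eq_map => a.
by rewrite /tau1 /= mulrCA.
Qed.

Lemma comb_inD xs us : all inD3 us -> inD3 (comb xs us).
Proof.
move=> h; rewrite -inD3_pb pb_comb; apply: comb2_inD.
by rewrite all_map; apply: sub_all h => u; rewrite /= inD3_pb.
Qed.

Lemma comb_bound us : all inD3 us -> exists2 K : R, 0 <= K &
  forall xs, sq (pb (comb xs us)) <= K * sumsq xs /\ sq (ps (comb xs us)) <= K * sumsq xs.
Proof.
move=> h.
have [|K1 K10 h1] := @comb2_bound [seq pb x | x <- us].
  by rewrite all_map; apply: sub_all h => u; rewrite /= inD3_pb.
have [|K2 K20 h2] := @comb2_bound [seq ps x | x <- us].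
  by rewrite all_map; apply: sub_all h => u; rewrite /= inD3_ps.
exists (K1 + K2); first by lra.
move=> xs; rewrite pb_comb ps_comb; have := h1 xs; have := h2 xs.
have := sumsq_ge0 xs; move: (sumsq xs) => s s0.
by have := mulr_ge0 K10 s0; have := mulr_ge0 K20 s0; split; lra.
Qed.

(** The constant [mu] makes the property stable under perturbation; sizes must agree because [comb]
    truncates to the shorter list. *)
Definition negfam (us : seq (seq (C * C * C))) : Prop :=
  exists2 mu : R, 0 < mu & forall xs, size xs = size us ->
    pform (comb xs us) <= - (mu * sumsq xs).

Lemma sub1_modc_gt0 (w : C) : modc w < 1 -> 0 < 1 - modc w ^+ 2.
Proof. by move=> h; rewrite subr_gt0 expr_lt1 ?modc_ge0. Qed.

Lemma szk_diag (w : C) : szk w w = rc (1 - modc w ^+ 2)^-1.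
Proof. by rewrite /szk -modc_sqrC -(rmorph1 rc) -rmorphB -fmorphV. Qed.

Lemma sz_diag (w : C) : sz [:: (w, 1)] [:: (w, 1)] = rc (1 - modc w ^+ 2)^-1.
Proof. by rewrite /sz !big_seq1 /= conj1 !mul1r szk_diag. Qed.

Lemma modc_sqrD_le (a b : C) : modc a ^+ 2 <= 2 * modc (a + b) ^+ 2 + 2 * modc b ^+ 2.
Proof.
rewrite !modc_sqr; case: a => a1 a2; case: b => b1 b2 /=.
have := sqr_ge0 (a1 + 2 * b1); have := sqr_ge0 (a2 + 2 * b2); lra.
Qed.

(* Pivoting on the negative vector (w, 0, g): the Schur complement of the Pick
   form is the Pick form of the pairs (b, b_w s). *)
Lemma negfam_pivot us (w g : C) : modc w < 1 -> g != 0 -> all inD3 us ->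
  negfam [seq tau w x | x <- us] -> negfam ([:: (w, 0, g)] :: us).
Proof.
move=> w1 g0 hus [mu mu0 hneg].
have [K K0 hK] := comb_bound hus.
have k0 := sub1_modc_gt0 w1; set k := 1 - modc w ^+ 2 in k0.
have gp : 0 < modc g ^+ 2 by rewrite exprn_gt0 // modc_gt0.
(* The split-off square k |A + ze|^2 controls |c|^2 only up to the cross pairing [ze]. Using just a
   fraction t of it makes the loss from [ze] at most half of the margin mu; [nu] is the resulting
   margin for the coefficient c. *)
pose t := Num.min 1 (mu / (2 * (K + 1))).
have t0 : 0 < t by rewrite lt_min ltr01 divr_gt0 //; lra.
have t1 : t <= 1 by rewrite ge_min lexx.
have tK : t * (2 * (K + 1)) <= mu.
  by rewrite -ler_pdivlMr; [rewrite ge_min lexx orbT|lra].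
pose nu := t * modc g ^+ 2 / (2 * k).
have nu0 : 0 < nu by rewrite divr_gt0 // mulr_gt0.
exists (Num.min (mu / 2) nu); first by rewrite lt_min nu0 andbT; lra.
case=> [|c xs] //= [sx].
have := hneg xs; rewrite size_map => /(_ sx); rewrite -tau_comb.
have hv := comb_inD xs hus; have [_ hKs] := hK xs.
set v := comb xs us in hv hKs *.
rewrite /pform pb_tau ps_tau /= mulr0 sq_cons0 => hn.
have hd : inDs ((w, c * g) :: ps v) by rewrite /inDs /= w1 -/(inDs _) inD3_ps.
rewrite (sq_schur w1 hd) /= bf_self mul0r sq_cons0.
rewrite sz_cons sz_atom sz_diag -/k.
set ze := sz (ps v) _; set A := c * g * _.
have zeb : k * modc ze ^+ 2 <= K * sumsq xs.
  apply: le_trans hKs; rewrite (sq_schur w1 (_ : inDs (ps v))) ?inD3_ps // -/k -/ze.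
  by rewrite lerDr sq_ge0 // inDs_wt inD3_ps.
have AE : k * modc A ^+ 2 = modc c ^+ 2 * modc g ^+ 2 / k.
  rewrite /A !modcM modc_real ger0_norm ?invr_ge0 ?(ltW k0) //.
  by field; rewrite gt_eqF.
have tri := modc_sqrD_le A ze.
have := ler_wpM2l (ltW k0) tri => tri'.
set X := k * modc (A + ze) ^+ 2 in tri' *.
have X0 : 0 <= X by rewrite mulr_ge0 ?sqr_ge0 // ltW.
have Xt : t * X <= X by rewrite ler_piMl.
have tX : t * (k * modc A ^+ 2) <= t * (2 * X + 2 * (K * sumsq xs)).
  by apply: ler_wpM2l; [exact: ltW|rewrite /X; lra].
have nuE : t * (k * modc A ^+ 2) = 2 * (nu * modc c ^+ 2).
  by rewrite AE /nu; field; rewrite gt_eqF.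
have s0 := sumsq_ge0 xs; have c0 := sqr_ge0 (modc c).
have tKs := ler_wpM2r s0 tK.
have tS := mulr_ge0 (ltW t0) s0.
set mm := Num.min _ _.
have m1 : mm * sumsq xs <= mu / 2 * sumsq xs.
  by apply: ler_wpM2r => //; rewrite ge_min lexx.
have m2 : mm * modc c ^+ 2 <= nu * modc c ^+ 2.
  by apply: ler_wpM2r => //; rewrite ge_min lexx orbT.
rewrite sumsq_cons; lra.
Qed.

(** [sz_young] bounds the cross terms. The new vector is compared with [x ++ d] through pairings
    only, as different lists may represent one functional. *)
Lemma negfam_perturb us x : inD3 x -> all inD3 us -> negfam (x :: us) ->
  exists2 eta : R, 0 < eta & forall d x', inD3 d ->
    sq (pb d) <= eta -> sq (ps d) <= eta ->
    (forall v, sz (pb x') v = sz (pb (x ++ d)) v) ->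
    (forall v, sz (ps x') v = sz (ps (x ++ d)) v) -> negfam (x' :: us).
Proof.
move=> hx hus [mu mu0 hneg].
have [|K K0 hK] := @comb_bound (x :: us); first by rewrite /= hx.
pose t := mu / (8 * (K + 1)).
have t0 : 0 < t by rewrite divr_gt0 //; lra.
have tK : t * (8 * (K + 1)) = mu by rewrite divfK // gt_eqF //; lra.
(* The perturbation costs eta (1 + 2 / t) |c|^2 and 2 t K times [sumsq]; t and eta make each at most
   mu/4 times [sumsq]. *)
have q0 : 0 < 1 + 2 / t by have := divr_gt0 (ltr0n R 2) t0; lra.
pose eta := mu / 4 / (1 + 2 / t).
have eta0 : 0 < eta by rewrite divr_gt0 //; lra.
have etaE : eta * (1 + 2 / t) = mu / 4 by rewrite divfK // gt_eqF.
exists eta => // d x' hd db ds eb es.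
exists (mu / 2); first by lra.
case=> [|c xs] //= [sx].
have := hneg (c :: xs); rewrite /= sx => /(_ erefl).
have [/= hKb hKs] := hK (c :: xs).
have hx0 : inD3 (comb (c :: xs) (x :: us)) by apply: comb_inD; rewrite /= hx.
rewrite /= in hx0; set x0 := scl3 c x ++ comb xs us in hKb hKs hx0 *.
have Eb : sq (pb (scl3 c x' ++ comb xs us)) = sq (pb x0 ++ wt (fun=> c) (pb d)).
  apply: sq_eqv => v; rewrite /x0 !pb_cat !pb_scl3 !sz_catl !sz_sclL eb pb_cat sz_catl.
  by ring.
have Es : sq (ps (scl3 c x' ++ comb xs us)) = sq (ps x0 ++ wt (fun=> c) (ps d)).
  apply: sq_eqv => v; rewrite /x0 !ps_cat !ps_scl3 !sz_catl !sz_sclL es ps_cat sz_catl.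
  by ring.
rewrite /pform Eb Es !sq_cat.
have yb := sz_young t0 (_ : inDs (pb x0)) (_ : inDs (wt (fun=> c) (pb d))).
have {}yb := yb (ltac:(by rewrite inD3_pb)) (ltac:(by rewrite inDs_wt inD3_pb)).
have ys := sz_young t0 (_ : inDs (ps x0)) (_ : inDs (wt (fun=> c) (ps d))).
have {}ys := ys (ltac:(by rewrite inD3_ps)) (ltac:(by rewrite inDs_wt inD3_ps)).
have nb := ler_norm (complex.Re (sz (pb x0) (wt (fun=> c) (pb d)))).
have ns := ler_norm (- complex.Re (sz (ps x0) (wt (fun=> c) (ps d)))).
rewrite normrN in ns.
rewrite !sq_scl in yb ys *.
have c0 := sqr_ge0 (modc c).
have db' := ler_wpM2l c0 db; have ds' := ler_wpM2l c0 ds.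
have sd0 : 0 <= modc c ^+ 2 * sq (ps d) by rewrite mulr_ge0 // sq_ge0 // inD3_ps.
have it0 : 0 <= t^-1 by rewrite invr_ge0 ltW.
have db2 := ler_wpM2r it0 db'; have ds2 := ler_wpM2r it0 ds'.
have tb := ler_wpM2l (ltW t0) hKb; have ts := ler_wpM2l (ltW t0) hKs.
have s0 := sumsq_ge0 (c :: xs).
have ce := congr1 (fun r => modc c ^+ 2 * r) etaE; rewrite /= in ce.
have tKs := congr1 (fun r => r * sumsq (c :: xs)) tK; rewrite /= in tKs.
have cs : modc c ^+ 2 <= sumsq (c :: xs) by rewrite sumsq_cons lerDl sumsq_ge0.
have mcs := ler_wpM2l (ltW mu0) cs.
have ts0 := mulr_ge0 (ltW t0) s0.
move: (sumsq (c :: xs)) s0 hKb hKs tb ts tKs cs mcs ts0 => n s0 hKb hKs tb ts tKs cs mcs ts0.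
move=> main; lra.
Qed.

(* The best approximation of the evaluation at [w] by those at [zs] in the Szego
   norm; its error is governed by the Blaschke product of [zs]. *)
Lemma szego_dist (w : C) zs : modc w < 1 -> all (fun z => modc z < 1) zs -> uniq zs ->
  exists a : seq (C * C), map fst a = zs /\
    sq (a ++ [:: (w, 1)]) <= modc (bl zs w) ^+ 2 / (1 - modc w ^+ 2).
Proof.
move=> w1; elim: zs => [_ _|z zs IH /= /andP[z1 hz] /andP[zn un]].
  exists [::]; split=> //=; rewrite /bl big_nil modc1 expr1n mul1r.
  by rewrite /sq sz_diag.
have [a [aE ha]] := IH hz un.
have k0 := sub1_modc_gt0 z1.
(* Multiplying by [bf z] turns these weights, and the weight 1 at w, into [bf z w] times the earlier
   ones. *)
pose a2 := [seq (p.1, bf z w * p.2 / bf z p.1) | p <- a].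
pose u := a2 ++ [:: (w, 1)].
(* The weight at z that makes the pairing with the kernel at z vanish. *)
pose y := - rc (1 - modc z ^+ 2) * sz u [:: (z, 1)].
have aD : inDs (a ++ [:: (w, 1)]).
  rewrite /inDs all_cat /= w1 /= andbT; apply/allP => p pa.
  by apply: (allP hz); rewrite -aE map_f.
have uD : inDs u.
  rewrite /inDs all_cat /= w1 /= andbT all_map; apply/allP => p pa /=.
  by apply: (allP hz); rewrite -aE map_f.
exists ((z, y) :: a2); split=> /=; first by rewrite -aE -map_comp.
rewrite -/u (sq_schur z1); last by rewrite /inDs /= z1.
rewrite /= bf_self mul0r sq_cons0 sz_cons sz_atom sz_diag.
have -> : y * rc (1 - modc z ^+ 2)^-1 + sz u [:: (z, 1)] = 0.
  rewrite /y fmorphV mulrAC mulNr divff ?mulN1r ?addNr //.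
  by rewrite -(rmorph0 rc) (inj_eq (@complexI _)) gt_eqF.
rewrite modc0 expr0n mulr0 addr0.
have -> : wt (bf z) u = wt (fun=> bf z w) (a ++ [:: (w, 1)]).
  rewrite /u /wt !map_cat /= mulr1; congr (_ ++ _); rewrite -map_comp.
  apply/eq_in_map => p pa /=; congr (_, _).
  have pz : p.1 \in zs by rewrite -aE map_f.
  rewrite mulrC divfK //; apply: bf_neq0 => //; first exact: (allP hz).
  by apply: contraNneq zn => <-.
rewrite sq_scl; apply: le_trans (ler_wpM2l (sqr_ge0 _) ha) _.
by rewrite bl_cons [modc (_ * bl zs w)]modcM exprMn mulrA.
Qed.

Section Open.
Variable O : C -> Prop.
Hypotheses (oO : openC O) (nO : exists z, O z) (dO : forall z, O z -> modc z < 1).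

(** The radius m does not depend on n, so each Blaschke factor at w is bounded by one constant below
    1. *)
Lemma open_points (F : seq C) : exists2 m : R, 0 <= m < 1 & forall n,
  exists zs : seq C, [/\ uniq zs, size zs = n &
    forall z, z \in zs -> [/\ O z, z \notin F & modc z <= m]].
Proof.
have [z0 Oz0] := nO; have [r [r0 hr]] := oO Oz0; have z01 := dO Oz0.
have rE : r = rc (modc r) by rewrite -normcE_modc gtr0_norm.
have rp : 0 < modc r by rewrite modc_gt0 gt_eqF.
pose rho := Num.min (modc r) (1 - modc z0).
have rho0 : 0 < rho by rewrite lt_min rp subr_gt0.
have rho1 : rho <= modc r by rewrite ge_min lexx.
have rho2 : rho <= 1 - modc z0 by rewrite ge_min lexx orbT.
have z00 := modc_ge0 z0.
exists ((1 + modc z0) / 2); first by lra.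
pose pt (k : nat) := z0 + rc (rho / k.+2%:R).
have ptI : injective pt.
  move=> i j /addrI /complexI /mulfI => /(_ (lt0r_neq0 rho0)) /invr_inj /eqP.
  by rewrite eqr_nat => /eqP[].
have hpt k : O (pt k) /\ modc (pt k) <= (1 + modc z0) / 2.
  have k2 : rho / k.+2%:R <= rho / 2.
    by apply: ler_wpM2l; [exact: ltW|rewrite lef_pV2 ?posrE // ler_nat].
  have kp : 0 < rho / k.+2%:R by rewrite divr_gt0.
  have m1 : modc (rc (rho / k.+2%:R)) = rho / k.+2%:R by rewrite modc_real gtr0_norm.
  move: k2 kp m1; rewrite /pt; move: (rho / k.+2%:R) => d k2 kp m1.
  split; last by have := modcD z0 (rc d); rewrite m1; lra.
  by apply: hr; rewrite rE addrAC subrr add0r normcE_modc m1 ltcR; lra.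
elim=> [|n [zs [uz sz hz]]]; first by exists [::].
pose cand := [seq pt k | k <- iota 0 (size (F ++ zs)).+1].
have [z zc zn] : exists2 z, z \in cand & z \notin F ++ zs.
  apply/hasP; rewrite -[has _ _]negbK; apply/negP; rewrite -all_predC => /allP h.
  have : (size cand <= size (F ++ zs))%N.
    apply: uniq_leq_size; first by rewrite map_inj_uniq ?iota_uniq.
    by move=> z /h /=; rewrite negbK.
  by rewrite size_map size_iota ltnn.
move: zn; rewrite mem_cat negb_or => /andP[zF zzs].
exists (z :: zs); split=> /=; [by rewrite zzs|by rewrite sz|].
move=> x; rewrite inE => /orP[/eqP ->|/hz//].
by move/mapP: zc => [k _ ->] in zF *; have [] := hpt k.
Qed.

Lemma szego_approx (w : C) (F : seq C) (eta : R) : modc w < 1 -> 0 < eta ->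
  exists a : seq (C * C), (forall p, p \in a -> O p.1 /\ p.1 \notin F) /\
    sq (a ++ [:: (w, 1)]) <= eta.
Proof.
move=> w1 eta0; have [m /andP[m0 m1] hm] := open_points F.
have k0 := sub1_modc_gt0 w1; set k := 1 - modc w ^+ 2 in k0.
(* By [pseudohyp], |b_z(w)|^2 = 1 - (1 - |z|^2)(1 - |w|^2) / |1 - conj(z) w|^2, with denominator at
   most 4. *)
pose q := 1 - (1 - m ^+ 2) * k / 4.
have mm : 0 < 1 - m ^+ 2 <= 1 by rewrite subr_gt0 expr_lt1 // m1 /= gerBl sqr_ge0.
have kk : k <= 1 by rewrite gerBl sqr_ge0.
have mk : 0 < (1 - m ^+ 2) * k <= 1.
  case/andP: mm => a1 a2; rewrite mulr_gt0 //= -[X in _ <= X]mulr1.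
  by apply: ler_pM => //; exact: ltW.
have qq : 0 <= q < 1 by rewrite /q; lra.
have bq z : modc z <= m -> modc (bf z w) ^+ 2 <= q.
  move=> zm; have z1 : modc z < 1 by lra.
  have ph := pseudohyp w z.
  have n0 := sub1_neq0' w1 z1; rewrite -modc_gt0 in n0.
  rewrite modcM modcV expr_div_n ler_pdivrMr ?exprn_gt0 //.
  have z0 := modc_ge0 z; have w0 := modc_ge0 w.
  have D2 : modc (1 - z^* * w) ^+ 2 <= 4.
    have h : modc (1 - z^* * w) <= 2.
      have := modcB 1 (z^* * w); rewrite modc1 modcM modcJ.
      have : modc z * modc w <= 1 * 1 by apply: ler_pM; lra.
      lra.
    have : modc (1 - z^* * w) * modc (1 - z^* * w) <= 2 * 2 by apply: ler_pM; rewrite ?modc_ge0.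
    by rewrite expr2; lra.
  have zz : 1 - m ^+ 2 <= 1 - modc z ^+ 2.
    by rewrite lerD2l lerN2 lerXn2r // nnegrE.
  have p1 : (1 - m ^+ 2) * k <= (1 - modc w ^+ 2) * (1 - modc z ^+ 2).
    by rewrite mulrC -/k; apply: ler_wpM2l => //; exact: ltW.
  have p2 : (1 - m ^+ 2) * k / 4 * modc (1 - z^* * w) ^+ 2 <= (1 - m ^+ 2) * k / 4 * 4.
    by apply: ler_wpM2l => //; lra.
  rewrite /q; lra.
have [n hn] := pow_tends0 qq (mulr_gt0 eta0 k0).
have [zs [uz sz hz]] := hm n.
have zD : all (fun z => modc z < 1) zs.
  by apply/allP => z /hz[_ _ zm]; lra.
have [a [aE ha]] := szego_dist w1 zD uz.
exists a; split.
  by move=> p pa; have [] := hz p.1 (ltac:(by rewrite -aE map_f)).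
apply: le_trans ha _; rewrite -/k ler_pdivrMr //; apply: le_trans (ltW hn).
rewrite -sz /bl modc_prod; case/andP: qq => q0 _.
have : forall z, z \in zs -> modc (bf z w) ^+ 2 <= q by move=> z /hz[_ _ /bq].
elim: (zs) => [_|z s IH h]; first by rewrite big_nil expr1n expr0.
rewrite big_cons exprMn /= [q ^+ _]exprS; apply: ler_pM; rewrite ?sqr_ge0 //.
  by apply: h; rewrite mem_head.
by apply: IH => x xs; apply: h; rewrite inE xs orbT.
Qed.

(* Multiples of evaluations of (be, si) at points of [O] outside [F], and multiples
   of the jump vectors in [J]. *)
Definition allowed (F : seq C) (be si : C -> C) (J : seq (C * C * C)) (a : C * C * C) :=
  (exists c, [/\ O a.1.1, a.1.1 \notin F, a.1.2 = c * be a.1.1 & a.2 = c * si a.1.1]) \/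
  (exists2 j, j \in J & exists c, a = (j.1.1, c * j.1.2, c * j.2)).

Definition basel (be si : C -> C) (u : seq (C * C)) : seq (C * C * C) :=
  [seq (p.1, p.2 * be p.1, p.2 * si p.1) | p <- u].

Lemma pb_basel be si u : pb (basel be si u) = wt be u.
Proof. by rewrite /pb /basel /wt -map_comp; apply: eq_map => p /=; rewrite mulrC. Qed.
Lemma ps_basel be si u : ps (basel be si u) = wt si u.
Proof. by rewrite /ps /basel /wt -map_comp; apply: eq_map => p /=; rewrite mulrC. Qed.

Lemma map_lift (T : eqType) (P : T -> Prop) (f : T -> T) (v : seq T) :
  (forall a, a \in v -> exists2 b, P b & f b = a) ->
  exists2 u, (forall b, b \in u -> P b) & map f u = v.
Proof.
elim: v => [_|a v IH h]; first by exists [::].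
have [u uP uE] := IH (fun b bv => h b (ltac:(by rewrite inE bv orbT))).
have [b Pb bE] := h a (mem_head _ _).
exists (b :: u); last by rewrite /= uE bE.
by move=> x; rewrite inE => /orP[/eqP ->|/uP].
Qed.

(* The evaluation of (be, si) at [w] is a limit of combinations of evaluations at
   points of [O], and a quantitatively negative family survives small changes. *)
Lemma negfam_move us (F : seq C) (be si : C -> C) (w k : C) x x1 :
  modc w < 1 -> contractive be -> contractive si -> all inD3 us -> inD3 x ->
  (forall v, sz (pb x1) v = sz (pb x) v + k * be w * sz [:: (w, 1)] v) ->
  (forall v, sz (ps x1) v = sz (ps x) v + k * si w * sz [:: (w, 1)] v) ->
  negfam (x :: us) ->
  exists a : seq (C * C), (forall p, p \in a -> O p.1 /\ p.1 \notin F) /\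
    negfam ((x1 ++ scl3 k (basel be si a)) :: us).
Proof.
move=> w1 cb cs hus hx e1 e2 hn.
have [eta eta0 h] := negfam_perturb hx hus hn.
have K0 := sqr_ge0 (modc k).
pose e := eta / (modc k ^+ 2 + 1).
have e0 : 0 < e by rewrite divr_gt0 //; lra.
have ek : modc k ^+ 2 * e <= eta.
  have : e * (modc k ^+ 2 + 1) = eta by rewrite divfK // gt_eqF //; lra.
  lra.
have [a [ha hs]] := szego_approx F w1 e0.
have aD : inDs (a ++ [:: (w, 1)]).
  rewrite /inDs all_cat /= w1 /= andbT; apply/allP => p /ha[Op _]; exact: dO.
exists a; split=> //; apply: (h (scl3 k (basel be si (a ++ [:: (w, 1)])))).
- by rewrite -inD3_pb pb_scl3 inDs_wt pb_basel inDs_wt.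
- rewrite pb_scl3 sq_scl pb_basel; apply: le_trans ek; rewrite ler_wpM2l //.
  by apply: le_trans hs; exact: cb.
- rewrite ps_scl3 sq_scl ps_basel; apply: le_trans ek; rewrite ler_wpM2l //.
  by apply: le_trans hs; exact: cs.
- move=> v; rewrite !pb_cat !pb_scl3 !pb_basel wt_cat !sz_catl !sz_sclL e1 sz_catl.
  by rewrite /wt /= mulr1 (sz_atom w (be w)); ring.
- move=> v; rewrite !ps_cat !ps_scl3 !ps_basel wt_cat !sz_catl !sz_sclL e2 sz_catl.
  by rewrite /wt /= mulr1 (sz_atom w (si w)); ring.
Qed.

Lemma allowed_inD F be si J a : all (fun j : C * C * C => modc j.1.1 < 1) J ->
  allowed F be si J a -> modc a.1.1 < 1.
Proof.
by move=> hJ [[c [Oa _ _ _]]|[j jJ [c ->]]]; [exact: dO|exact: (allP hJ _ jJ)].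
Qed.

(** Each step removes one zero or one jump. The last condition says that no jump vector is parallel
    to (B, si) at its point: a pivot at a zero leaves that determinant unchanged, a pivot at a jump
    w multiplies it by b_w at another jump point. *)
Lemma pick_lower_bound n ws (si : C -> C) (J : seq (C * C * C)) (F : seq C) :
  (size ws + size J)%N = n ->
  all (fun w => modc w < 1) ws -> all (fun j : C * C * C => modc j.1.1 < 1) J ->
  uniq [seq j.1.1 | j <- J] -> contractive si ->
  (forall w, w \in ws -> si w != 0) ->
  (forall j, j \in J -> j.1.2 * si j.1.1 != j.2 * bl ws j.1.1) ->
  exists us, [/\ size us = n,
    forall x, x \in us -> forall a, a \in x -> allowed F (bl ws) si J a & negfam us].
Proof.
elim: n ws si J F => [|n IH] ws si J F.
  move=> sz0 _ _ _ _ _ _; exists [::]; split=> //; exists 1 => // -[|//] _.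
  by rewrite /pform /= /sq !sz_nill subrr mul1r /sumsq big_nil oppr0.
have liftall w (al al' : C * C * C -> Prop) (us' : seq (seq (C * C * C))) :
    (forall a, al' a -> exists2 b, al b & tau1 w b = a) ->
    (forall x, x \in us' -> forall a, a \in x -> al' a) ->
    exists2 us, (forall x, x \in us -> forall a, a \in x -> al a) &
      [seq tau w x | x <- us] = us'.
  move=> lift h; apply: (map_lift (P := fun x => forall a, a \in x -> al a)) => x xu.
  by apply: map_lift => a ax; apply: lift; apply: h ax.
case: ws => [|w ws].
  case: J => [//|[[w b] s] J] [sJ] _ /= /andP[w1 hJ] /andP[wJ uJ] cs _ det.
  pose si' z := bf w z * si z.
  have cs' : contractive si'.
    move=> u hu; rewrite -(wt_comp (bf w) si).
    by apply: le_trans (sq_bf_le w1 _) (cs _ hu); rewrite inDs_wt.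
  have [||||||us1 [su' al' neg']] := IH [::] si' [seq tau1 w j | j <- J] F _ isT.
  - by rewrite size_map.
  - by rewrite all_map.
  - by rewrite -map_comp.
  - by [].
  - by [].
  - move=> _ /mapP[j jJ ->] /=; have dj := det j (ltac:(by rewrite inE jJ orbT)).
    rewrite /si' mulrCA -mulrA -subr_eq0 -mulrBr mulf_neq0 ?subr_eq0 //.
    apply: bf_neq0 => //; first exact: (allP hJ).
    by apply: contraNneq wJ => <-; exact: (map_f (fun j : C * C * C => j.1.1) jJ).
  pose al := allowed F (bl [::]) si ((w, b, s) :: J).
  have [us usA usE] : exists2 us, (forall x, x \in us -> forall a, a \in x -> al a) &
      [seq tau w x | x <- us] = us1.
    apply: liftall al' => -[[z b'] s'] [[c [/= Oz zF bE sE]]|[_ /mapP[j jJ ->] [c [-> -> ->]]]].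
      exists (z, b', c * si z); first by left; exists c.
      by rewrite /tau1 /= sE /si' mulrCA.
    exists (j.1.1, c * j.1.2, c * j.2); last by rewrite /tau1 /= mulrCA.
    by right; exists j; [rewrite inE jJ orbT|exists c].
  have usD : all inD3 us.
    apply/allP => x xu; apply/allP => a ax; apply: (allowed_inD _ (usA _ xu _ ax)).
    by rewrite /= w1.
  have g0 : s - b * si w != 0.
    have := det (w, b, s) (mem_head _ _); rewrite /= /bl big_nil mulr1.
    by rewrite eq_sym subr_eq0.
  have := negfam_pivot w1 g0 usD; rewrite usE => /(_ neg') neg.
  (* Here (0, s - b si(w)) = (b, s) - b (1, si(w)): the jump vector is kept, and [a] approximates
     minus the evaluation at w. *)
  have [|||a [ha neg2]] := negfam_move F (x1 := [:: (w, b, s)]) (k := b) w1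
      (bl_contractive (ws := [::]) isT) cs usD _ _ _ neg.
  - by rewrite /inD3 /= w1.
  - move=> v; rewrite /pb /= sz_atom0 add0r sz_atom /bl big_nil mulr1 //.
  - move=> v; rewrite /ps /= sz_atom [in RHS]sz_atom; ring.
  exists (([:: (w, b, s)] ++ scl3 b (basel (bl [::]) si a)) :: us); split=> //.
    by rewrite /= -(size_map (tau w)) usE su'.
  move=> x; rewrite inE => /orP[/eqP ->|]; last exact: usA.
  move=> p; rewrite inE => /orP[/eqP ->|].
    by right; exists (w, b, s); [exact: mem_head|exists 1; rewrite /= !mul1r].
  move=> /mapP[_ /mapP[q qa ->] ->] /=; have [Oq qF] := ha q qa.
  by left; exists (b * q.2); rewrite /= -!mulrA.
rewrite addSn => -[sJ] /= /andP[w1 hws] hJ uJ cs nz det.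
have hws' : all (fun w => modc w < 1) (w :: ws) by rewrite /= w1.
(* The points must now avoid w too: lifting the vectors back divides their weights by b_w. *)
have [|||||us1 [su' al' neg']] :=
  IH ws si [seq tau1 w j | j <- J] (w :: F) _ hws _ _ cs.
- by rewrite size_map.
- by rewrite all_map.
- by rewrite -map_comp.
- by move=> x xws; apply: nz; rewrite inE xws orbT.
- move=> _ /mapP[j jJ ->] /=; have := det j jJ; rewrite bl_cons.
  by rewrite (mulrA j.2) (mulrC j.2).
pose al := allowed F (bl (w :: ws)) si J.
have [us usA usE] : exists2 us, (forall x, x \in us -> forall a, a \in x -> al a) &
    [seq tau w x | x <- us] = us1.
  apply: liftall al' => -[[z b'] s'] [[c [/= Oz zF bE sE]]|[_ /mapP[j jJ ->] [c [-> -> ->]]]].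
    move: zF; rewrite inE negb_or => /andP[zw zF].
    have bz := bf_neq0 w1 (dO Oz) zw.
    exists (z, b', c / bf w z * si z).
      by left; exists (c / bf w z); split=> //=; rewrite bE bl_cons mulrA divfK.
    by rewrite /tau1 /= sE mulrA [bf w z * _]mulrC divfK.
  exists (j.1.1, c * j.1.2, c * j.2); last by rewrite /tau1 /= mulrCA.
  by right; exists j => //; exists c.
have usD : all inD3 us.
  by apply/allP => x xu; apply/allP => a ax; apply: (allowed_inD hJ (usA _ xu _ ax)).
have := negfam_pivot w1 (nz w (mem_head _ _)) usD; rewrite usE => /(_ neg') neg.
(* At a zero of B the negative vector is the evaluation of (B, si) itself; the sign is there because
   [a] approximates its negative. *)
have [|||a [ha neg2]] := negfam_move F (x1 := [::]) (k := -1) w1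
    (bl_contractive hws') cs usD _ _ _ neg.
- by rewrite /inD3 /= w1.
- by move=> v; rewrite /pb /= sz_nill sz_atom0 bl_cons bf_self mul0r mulr0 mul0r addr0.
- by move=> v; rewrite /ps /= sz_nill [in RHS]sz_atom; ring.
exists (([::] ++ scl3 (-1) (basel (bl (w :: ws)) si a)) :: us); split=> //.
  by rewrite /= -(size_map (tau w)) usE su'.
move=> x; rewrite inE => /orP[/eqP ->|]; last exact: usA.
move=> _ /mapP[_ /mapP[q qa ->] ->] /=; have [Oq qF] := ha q qa.
by left; exists (-1 * q.2); rewrite /= -!mulrA.
Qed.

End Open.
End Negative.

(** * From Pick forms of lists to Pick matrices *)

Section Pick_matrices.
Variable R : realType.
Local Notation C := (R[i]).
Local Notation rc := (real_complex R).

(** Each condition kills the rank-one term of the kernel identity for one factor; all are linear in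
    the weights, one per zero with multiplicity. *)
Lemma sq_bl_eq ws (u : seq (C * C)) : all (fun w => modc w < 1) ws -> inDs u ->
  (forall l, (l < size ws)%N -> sz (wt (bl (take l ws)) u) [:: (nth 0 ws l, 1)] = 0) ->
  sq (wt (bl ws) u) = sq u.
Proof.
have wt_nil v : wt (bl [::]) v = v.
  rewrite -[RHS]map_id; apply: eq_map => -[z c] /=.
  by rewrite /bl big_nil mul1r.
elim: ws u => [|w ws IH] u; first by rewrite wt_nil.
move=> /= /andP[w1 hws] hu h.
have wtE vs : wt (bl (w :: vs)) u = wt (bl vs) (wt (bf w) u).
  by rewrite wt_comp; apply: eq_in_wt => a _; rewrite bl_cons [bf w _ * _]mulrC.
rewrite wtE IH ?inDs_wt // => [|l lt]; last by rewrite -wtE; exact: (h l.+1).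
have := h 0%N isT; rewrite /= wt_nil => e.
by rewrite [RHS](sq_schur w1 hu) e modc0 expr0n mulr0 addr0.
Qed.

Definition pts n (z y : 'I_n -> C) : seq (C * C) := [seq (z i, y i) | i <- index_enum 'I_n].

Lemma hform_pick n (f be si : C -> C) (z y : 'I_n -> C) (x : 'rV[C]_n) :
  (forall i, x 0 i = be (z i) * y i) ->
  (forall i, x 0 i * f (z i) = si (z i) * y i) ->
  hform (pick_mx f z) x = rc (sq (wt be (pts z y)) - sq (wt si (pts z y))).
Proof.
move=> e1 e2; rewrite rmorphB /= !rc_sq /sz /wt /pts !big_map -sumrB.
apply: eq_bigr => i _; rewrite !big_map -sumrB; apply: eq_bigr => j _ /=.
rewrite mxE /szk -e1 -e1 -e2 -e2 !conjM; ring.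
Qed.

Lemma pick_upper_bound ws (Zs : seq C) (f si : C -> C) n (z : 'I_n -> C) :
  all (fun w => modc w < 1) ws -> contractive si -> injective z ->
  (forall i, modc (z i) < 1) ->
  (forall i, z i \notin Zs -> bl ws (z i) != 0 /\ f (z i) = si (z i) / bl ws (z i)) ->
  (sqm (pick_mx f z) <= size ws + size Zs)%N.
Proof.
move=> hws cs zi zD fE.
(* The congruence x = B y, inverted off the jumps; the columns of [M2] force x to vanish at the
   jumps, where y is set to 0. *)
pose wy i : C := if z i \in Zs then 0 else (bl ws (z i))^-1.
pose M1 := \matrix_(i < n, l < size ws)
  (bl (take l ws) (z i) * wy i * szk (z i) (nth 0 ws l)).
pose M2 := \matrix_(i < n, j < size Zs) ((z i == nth 0 Zs j)%:R : C).
apply: (sqm_le (M := row_mx M1 M2)); first exact: pick_mx_hermitian.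
move=> x; rewrite mul_mx_row => /eqP; rewrite row_mx_eq0 => /andP[/eqP x1 /eqP x2].
have xZ i : z i \in Zs -> x 0 i = 0.
  move=> iZ; have jlt : (index (z i) Zs < size Zs)%N by rewrite index_mem.
  have /rowP /(_ (Ordinal jlt)) := x2; rewrite !mxE (bigD1 i) //= !mxE nth_index // eqxx.
  rewrite mulr1 big1 ?addr0 // => k ki; rewrite !mxE /= nth_index //.
  by rewrite (inj_eq zi) (negbTE ki) mulr0.
pose y i := wy i * x 0 i.
have xE i : x 0 i = bl ws (z i) * y i.
  rewrite /y /wy; case: ifPn => [/xZ ->|/fE[b0 _]]; first by rewrite !mulr0.
  by rewrite mulrA divff // mul1r.
have sE i : x 0 i * f (z i) = si (z i) * y i.
  rewrite /y /wy; case: ifPn => [/xZ ->|/fE[b0 ->]]; first by rewrite !(mul0r, mulr0).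
  by rewrite mulrC mulrA.
rewrite (hform_pick xE sE) ler0c subr_ge0.
have uD : inDs (pts z y) by rewrite /inDs all_map; apply/allP => i _ /=.
rewrite (sq_bl_eq hws uD); first exact: cs.
move=> l lt; have /rowP /(_ (Ordinal lt)) := x1; rewrite !mxE => e.
rewrite /sz /wt /pts !big_map -[RHS]e; apply: eq_bigr => i _.
by rewrite big_seq1 /= conj1 mulr1 !mxE /= /y; ring.
Qed.

(** Lists may repeat a point, whereas a Pick matrix is taken at distinct ones, so weights at equal
    points are added up. *)
Definition gather (x : seq (C * C * C)) (p : C) : C := \sum_(a <- x | a.1.1 == p) a.1.2.

Lemma gather_sum (x : seq (C * C * C)) (P : seq C) (G : C -> C) : uniq P ->
  (forall a, a \in x -> a.1.1 \in P) ->
  \sum_(i < size P) gather x (nth 0 P i) * G (nth 0 P i) =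
  \sum_(a <- x) a.1.2 * G a.1.1.
Proof.
move=> uP xP.
rewrite -(big_mkord xpredT (fun i => gather x (nth 0 P i) * G (nth 0 P i))).
rewrite -(big_nth 0 xpredT (fun p => gather x p * G p)).
under eq_bigr do rewrite /gather mulr_suml big_mkcond /=.
rewrite exchange_big /= big_seq [RHS]big_seq; apply: eq_bigr => a ax.
rewrite (bigD1_seq a.1.1) ?xP //= eqxx big1 ?addr0 // => p pa.
by rewrite eq_sym (negbTE pa).
Qed.

Lemma hform_gather (f : C -> C) (x : seq (C * C * C)) (P : seq C) : uniq P ->
  (forall a, a \in x -> a.1.1 \in P /\ a.2 = a.1.2 * f a.1.1) ->
  hform (pick_mx f (fun i : 'I_(size P) => nth 0 P i))
    (\row_i gather x (nth 0 P i)) = rc (pform x).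
Proof.
move=> uP h; have xP a : a \in x -> a.1.1 \in P by case/h.
pose K z w := (1 - f z * (f w)^*) / (1 - z * w^*).
have KJ z w : (K z w)^* = K w z.
  by rewrite /K !conjE [(f z)^* * _]mulrC [z^* * _]mulrC.
transitivity (\sum_(a <- x) a.1.2 * (\sum_(b <- x) b.1.2^* * K a.1.1 b.1.1)).
  rewrite -(gather_sum (fun p => \sum_(b <- x) b.1.2^* * K p b.1.1) uP xP).
  rewrite /hform; apply: eq_bigr => i _.
  rewrite mxE.
  have -> : \sum_(b <- x) b.1.2^* * K (nth 0 P i) b.1.1 =
      \sum_(j < size P) (gather x (nth 0 P j))^* * K (nth 0 P i) (nth 0 P j).
    apply: (inv_inj (@conjCK C)); rewrite !rmorph_sum /=.
    under eq_bigr do rewrite conjM conjCK KJ.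
    under [RHS]eq_bigr do rewrite conjM conjCK KJ.
    exact/esym/(gather_sum (fun p => K p (nth 0 P i)) uP xP).
  rewrite mulr_sumr; apply: eq_bigr => j _; rewrite !mxE /K; ring.
rewrite /pform rmorphB /= !rc_sq /sz /pb /ps !big_map -sumrB.
rewrite big_seq [RHS]big_seq; apply: eq_bigr => a /h[_ ->].
rewrite !big_map -sumrB mulr_sumr big_seq [RHS]big_seq; apply: eq_bigr => b /h[_ ->] /=.
by rewrite /K /szk !conjM; ring.
Qed.

Lemma gather_comb (xs : seq C) us p : size xs = size us ->
  gather (comb xs us) p = \sum_(k < size us) nth 0 xs k * gather (nth [::] us k) p.
Proof.
elim: xs us => [|c xs IH] [|u us] //=; first by rewrite big_ord0 /gather big_nil.
case=> sx; rewrite big_ord_recl /= -IH // /gather big_cat /=; congr (_ + _).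
by rewrite /scl3 big_map mulr_sumr.
Qed.

Lemma comb_mem (xs : seq C) (us : seq (seq (C * C * C))) (Q : C * C * C -> Prop) :
  (forall x, x \in us -> forall a, a \in x -> Q a) ->
  (forall a c, Q a -> Q (a.1.1, c * a.1.2, c * a.2)) ->
  forall a, a \in comb xs us -> Q a.
Proof.
move=> h hQ; elim: xs us h => [|c xs IH] [|u us] //= h a; rewrite mem_cat => /orP[].
  by move=> /mapP[b bu ->]; apply/hQ/(h u) => //; exact: mem_head.
by apply: IH => x xu; apply: h; rewrite inE xu orbT.
Qed.

Lemma negfam_sqm (f : C -> C) (us : seq (seq (C * C * C))) (P : seq C) : uniq P ->
  (forall x, x \in us -> forall a, a \in x -> a.1.1 \in P /\ a.2 = a.1.2 * f a.1.1) ->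
  negfam us ->
  (size us <= sqm (pick_mx f (fun i : 'I_(size P) => nth 0%R P i)))%N.
Proof.
move=> uP h [mu mu0 hneg].
pose V := \matrix_(k < size us, i < size P) gather (nth [::] us k) (nth 0 P i).
apply: (sqm_ge (V := V)); first exact: pick_mx_hermitian.
move=> x x0; pose xs := [seq x 0 k | k <- enum 'I_(size us)].
have sx : size xs = size us by rewrite size_map size_enum_ord.
have -> : x *m V = \row_i gather (comb xs us) (nth 0 P i).
  apply/rowP => i; rewrite !mxE gather_comb //; apply: eq_bigr => k _.
  by rewrite mxE (nth_map k) ?size_enum_ord // nth_ord_enum.
rewrite (hform_gather uP); last first.
  apply: (comb_mem (Q := fun a => a.1.1 \in P /\ a.2 = a.1.2 * f a.1.1) h).
  by move=> a c [aP ->]; split=> //=; rewrite mulrA.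
rewrite -(rmorph0 rc) ltcR; apply: le_lt_trans (hneg _ sx) _.
rewrite oppr_lt0 mulr_gt0 // lt_neqAle sumsq_ge0 andbT eq_sym.
apply: contra_neq x0; rewrite /sumsq /xs big_map big_enum /= => /eqP.
rewrite psumr_eq0 => [/allP e|k _]; last exact: sqr_ge0.
apply/rowP => k; rewrite mxE; apply/eqP.
by have := e k (mem_index_enum k); rewrite /= sqrf_eq0 modc_eq0.
Qed.

End Pick_matrices.

(** * Both bounds for the given standard function *)

Theorem mainTheorem5 (R : realType) (L : R[i] -> Prop) (f : R[i] -> R[i]) (kappa : nat)
    (S B gamma : R[i] -> R[i]) (q : nat) (Z W : seq R[i]) :
  discreteD L ->
  S_kappa L f kappa ->
  (* (S, B, Z, gamma, W) is the standard extension of f, with q poles,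
     all its jumps lying in D \ Lambda *)
  standard_data S B q Z gamma W ->
  (forall w, w \in W -> L w) ->
  (forall z, domD L z -> std_fun S B gamma Z z = f z) ->
  (forall z, z \in Z -> ~ L z) ->
  forall O : R[i] -> Prop,
    openC O -> (exists z, O z) -> (forall z, O z -> domD L z) ->
    exists n : nat, (0 < n)%N /\
      is_kn f O n (q + count (fun z => `[< O z >]) Z).
Proof.
move=> _ _ [uZ [_ [ZD [_ [_ [hB [hS [_ [BWZ [BS jmp]]]]]]]]]] WL fE _ O oO nO OL.
have [c [ws [c1 sws hws BE]]] := blaschke_prod hB.
have c0 : c != 0 by rewrite -modc_gt0 c1.
have cc : c * c^* = 1 by rewrite -modc_sqrC c1 expr1n.
(* B is c times a product of factors; the unimodular c is moved into the numerator. *)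
pose si z := c^* * S z.
have cs : contractive si.
  move=> u hu; rewrite -(wt_comp (fun=> c^*)) sq_scl modcJ c1 expr1n mul1r.
  exact: schur_contractive.
have OD z : O z -> modc z < 1 by move=> /OL[/inD_modc].
have siB z : modc z < 1 -> S z / B z = si z / bl ws z.
  move=> z1; rewrite BE // invfM /si mulrA; congr (_ * _).
  by apply: (mulfI c0); rewrite mulrCA divff // mulr1 mulrA cc mul1r.
have B0 z : modc z < 1 -> (B z == 0) = (bl ws z == 0).
  by move=> z1; rewrite BE // mulf_eq0 (negbTE c0).
have reg z : O z -> z \notin Z -> bl ws z != 0 /\ f z = si z / bl ws z.
  move=> Oz zZ; have z1 := OD z Oz; split; last first.
    by rewrite -fE /std_fun ?(negbTE zZ) ?siB //; exact: OL.
  apply/negP; rewrite -B0 // => /eqP /(BWZ z (proj2 (inD_modc z) z1)).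
  by rewrite (negbTE zZ) orbF => /WL; have [_] := OL z Oz.
pose Zs := [seq z <- Z | `[< O z >]].
have upper n (z : 'I_n -> R[i]) : distinct_in O z -> (sqm (pick_mx f z) <= q + size Zs)%N.
  move=> [zi Oz]; rewrite -sws; apply: (pick_upper_bound hws cs zi) => i.
    exact/OD/Oz.
  by rewrite mem_filter asboolT //= => zZ; exact: reg.
pose J : seq (R[i] * R[i] * R[i]) := [seq (z, 1, gamma z) | z <- Zs].
have ZsP z : z \in Zs -> O z /\ z \in Z by rewrite mem_filter => /andP[/asboolP].
(* Excluding [Z] keeps the evaluation points off the jumps, so that f = S / B there. *)
have [||||||us [sus al neg]] := @pick_lower_bound R O oO nO OD (q + size Zs) ws si J Z _ hws.
- by rewrite size_map sws.
- by rewrite all_map; apply/allP => z /ZsP[/OD].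
- by rewrite -map_comp map_id filter_uniq.
- exact: cs.
- move=> w wws; have w1 := allP hws _ wws.
  rewrite mulf_neq0 ?conjC_eq0 // BS //; first exact/inD_modc.
  by apply/eqP; rewrite B0 // bl_eq0.
(* At a zero of B the determinant is non-zero because S does not vanish there, elsewhere because the
   jump is genuine. *)
- move=> _ /mapP[z /ZsP[/OD z1 zZ] ->] /=; rewrite mul1r.
  have [b0|b0] := eqVneq (bl ws z) 0.
    rewrite b0 mulr0 mulf_neq0 ?conjC_eq0 // BS //; first exact/inD_modc.
    by apply/eqP; rewrite B0 // b0.
  have := jmp z zZ; rewrite B0 // siB // => /(_ b0).
  by apply: contra_neq => ->; rewrite mulfK.
have atom a : allowed O Z (bl ws) si J a -> O a.1.1 /\ a.2 = a.1.2 * f a.1.1.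
  move=> [[d [Oa aZ -> ->]]|[_ /mapP[z /ZsP[Oz zZ] ->] [d ->]]] /=.
    have [b0 ->] := reg _ Oa aZ; split=> //.
    by rewrite -mulrA; congr (_ * _); rewrite mulrC divfK.
  by split=> //; rewrite -fE /std_fun ?zZ ?mulr1 //; exact: OL.
have [z0 Oz0] := nO.
(* The extra point z0 makes n positive even when the family is empty. *)
pose P := undup (z0 :: [seq a.1.1 | a <- flatten us]).
have uP : uniq P by exact: undup_uniq.
have PO z : z \in P -> O z.
  rewrite mem_undup inE => /orP[/eqP ->//|/mapP[a /flattenP[x xus ax] ->]].
  by have [] := atom a (al _ xus _ ax).
have dP : distinct_in O (fun i : 'I_(size P) => nth 0 P i).
  split=> [i j /eqP|i]; last exact/PO/mem_nth.
  by rewrite nth_uniq // => /eqP /val_inj.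
have lower : (q + size Zs <= sqm (pick_mx f (fun i : 'I_(size P) => nth 0%R P i)))%N.
  rewrite -sus; apply: negfam_sqm => // x xus a ax.
  have [_ ->] := atom a (al _ xus _ ax); split=> //.
  rewrite mem_undup inE; apply/orP; right; apply/mapP; exists a => //.
  by apply/flattenP; exists x.
exists (size P); split.
  by rewrite lt0n size_eq0; apply: contraTneq (mem_head z0 [seq a.1.1 | a <- flatten us]); rewrite -mem_undup -/P => ->.
rewrite -size_filter -/Zs; split; last exact: upper.
exists (fun i => nth 0 P i); split=> //.
by apply/eqP; rewrite eqn_leq lower upper.
Qed.
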